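(* Let $\mathbf{F}$ be a finite field with $q$ elements, let $(G,\mathbf{V})$ be the infinite symplectic group over $\mathbf{F}$, and let $\mathbb{B}=\mathbb{B}(G,\mathbf{V})$ be its relative Burnside ring, with $\mathbb{Z}$-basis the classes $x_{a,b}$ of the $G$-sets $X_{a,b}$. There is a ring isomorphism $$\mathbb{Z}[1/q][X,Y]\to\mathbb{B}[1/q],\qquad X\mapsto x_{1,0},\quad Y\mapsto x_{0,1}.$$
   Context: A structure is an $\mathbf{F}$-vector space with an alternating bilinear form; an embedding is an injective linear map preserving forms. $\mathbf{V}$ has basis $\{e_i,f_i\}_{i\ge1}$ and form $\langle e_i,e_j\rangle=\langle f_i,f_j\rangle=0$, $\langle e_i,f_j\rangle=\delta_{i,j}$; $G$ is its group of form-preserving linear automorphisms. $V_{m,n}$ is the space of dimension $2m+n$ that is the orthogonal sum of a non-degenerate symplectic space of dimension $2m$ and an $n$-dimensional space with zero form; every finite dimensional structure is isomorphic to a unique $V_{m,n}$. $X_{m,n}$ is the set of embeddings $V_{m,n}\to\mathbf{V}$, with its transitive $G$-action by post-composition. A $G$-set is $\mathbf{V}$-smooth if all its stabilizers are pointwise stabilizers $G(A)$ of finite subsets $A\subset\mathbf{V}$; the $X_{m,n}$ are, up to isomorphism, exactly the transitive ones. The relative Burnside ring $\mathbb{B}(G,\mathbf{V})$ is the free abelian group on isomorphism classes of transitive $\mathbf{V}$-smooth $G$-sets, with the class of a $\mathbf{V}$-smooth $G$-set with finitely many orbits defined as the sum of the classes of its orbits, and product given by the class of the Cartesian product (which has finitely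 many orbits and is $\mathbf{V}$-smooth). *)

(* Defs.v *)
From HB Require Import structures.
From mathcomp Require Import all_boot all_order all_algebra.
From mathcomp Require Import sesquilinear generic_quotient ring.
From mathcomp Require Import boolp classical_sets functions cardinality fsbigop.
From mathcomp Require Import freeg.

Set Implicit Arguments.
Unset Strict Implicit.
Unset Printing Implicit Defensive.

Import GRing.Theory.
Local Open Scope classical_set_scope.
Local Open Scope group_scope.

Record gset (G : groupType) := GSet {
  gset_sort :> Type;
  act : G -> gset_sort -> gset_sort;
  act1 : forall x, act 1 x = x;
  actM : forall g h x, act (g * h) x = act g (act h x) }.

Section GSets.
Variable G : groupType.
Implicit Types X Y : gset G.

Definition gset_iso X Y : Prop :=
  exists f : X -> Y, bijective f /\ forall g x, f (act g x) = act g (f x).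

Definition orbit X (x : X) : set X := range (fun g => act g x).

Definition orbits X : set (set X) := range (@orbit X).
Arguments orbits X : clear implicits.

Definition gset_transitive X : Prop :=
  exists x : X, orbit x = setT.

Definition stabilizer X (x : X) : set G := [set g | act g x = x].

Definition pointwise_stabilizer X (A : set X) : set G :=
  [set g | forall a, A a -> act g a = a].

Definition smooth (Om X : gset G) : Prop :=
  forall x : X, exists2 A : set Om,
    finite_set A & stabilizer x = pointwise_stabilizer A.

Lemma actK X g : cancel (@act G X g) (@act G X g^-1).
Proof. by move=> x; rewrite -actM mulVg act1. Qed.

Lemma actKV X g : cancel (@act G X g^-1) (@act G X g).
Proof. by move=> x; rewrite -actM mulgV act1. Qed.

Lemma orbit_stable X (O : orbits X) g (y : val O) : act g (val y) \in val O.
Proof.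
case: O y => O /= OX [y /= yO]; apply: mem_set.
move: (set_mem OX) (set_mem yO) => [x _ <-] [h _ <-].
by exists (g * h); rewrite ?actM.
Qed.

Definition orbit_gset X (O : orbits X) : gset G.
Proof.
refine (@GSet G (val O) (fun g y => SigSub (orbit_stable g y)) _ _).
- by move=> x; apply: val_inj; rewrite /= act1.
- by move=> g h x; apply: val_inj; rewrite /= actM.
Defined.

Definition prod_gset X Y : gset G.
Proof.
refine (@GSet G (X * Y)%type (fun g z => (act g z.1, act g z.2)) _ _).
- by move=> [x y]; rewrite /= !act1.
- by move=> g h [x y]; rewrite /= !actM.
Defined.

Definition unit_gset : gset G.
Proof. by refine (@GSet G unit (fun _ z => z) _ _). Defined.

Definition seq_gset X : gset G.
Proof.
refine (@GSet G (seq X) (fun g => map (act g)) _ _).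
- by move=> s; rewrite (eq_map (@act1 _ X)) map_id.
- by move=> g h s; rewrite (eq_map (@actM _ X g h)) map_comp.
Defined.

End GSets.

Arguments orbits {G} X.
Arguments act1 {G} X : rename.
Arguments actM {G} X : rename.

Local Open Scope ring_scope.

Section Burnside.
Variables (G : groupType) (Om : gset G).
Implicit Types X Y : gset G.

Lemma mem_orbits X (x : X) : orbit x \in orbits X.
Proof. by apply: mem_set; exists x. Qed.

Definition orbit_of X (x : X) : orbits X := SigSub (mem_orbits x).

(* The isomorphism classes of all [G]-sets do not form a small type. Every
   transitive [Om]-smooth [G]-set is isomorphic to the orbit of a finite
   sequence of points of [Om], so we cut isomorphism classes down to this small
   family of representatives: see [iso_classP] below. *)
Definition tuple_orbit (s : seq_gset Om) : gset G := orbit_gset (orbit_of s).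

Definition iso_class X : set (seq Om) := [set s | gset_iso X (tuple_orbit s)].

Definition transitive_classes : set (set (seq Om)) :=
  [set c | exists X, [/\ gset_transitive X, smooth Om X & iso_class X = c]].

Definition burnside := {freeg transitive_classes}.
HB.instance Definition _ := GRing.Zmodule.on burnside.

Definition transitive_class X : burnside :=
  if insub (iso_class X) is Some k then << k >> else 0.

(* The sum over orbits takes a junk value unless [X] is [Om]-smooth with finitely
   many orbits. *)
Definition gset_class X : burnside :=
  \sum_(O \in [set: orbits X]) transitive_class (orbit_gset O).

Definition class_rep (k : transitive_classes) : gset G :=
  projT1 (cid (set_mem (valP k))).

(* The bilinear extension of the class of the Cartesian product. *)
Definition burnside_mul (x y : burnside) : burnside :=
  fglift (fun i => fglift (fun j =>
    gset_class (prod_gset (class_rep i) (class_rep j))) y) x.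

Definition burnside_one : burnside := gset_class (unit_gset G).

Lemma orbit_refl X (x : X) : orbit x x.
Proof. by exists 1%g => //; rewrite act1. Qed.

Lemma orbit_eq X (x y : X) : orbit x y -> orbit x = orbit y.
Proof.
move=> [g _ <-]; rewrite predeqE => z; split=> -[h _ <-].
  by exists (h * g^-1)%g => //; rewrite actM actK.
by exists (h * g)%g => //; rewrite actM.
Qed.

Lemma orbit_meet X (x x' y y' : X) g :
  orbit x y -> orbit x' y' -> act g y = y' -> orbit x x'.
Proof.
move=> xy xy' yy'; have oy : orbit y y' by exists g.
rewrite (orbit_eq xy) (orbit_eq oy) -(orbit_eq xy'); exact: orbit_refl.
Qed.

Lemma iso_refl X : gset_iso X X.
Proof. by exists id; split=> //; exists id. Qed.

Lemma iso_sym X Y : gset_iso X Y -> gset_iso Y X.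
Proof.
move=> [f [[f' fK f'K] fG]]; exists f'; split; first by exists f.
by move=> g y; apply: (can_inj fK); rewrite fG !f'K.
Qed.

Lemma iso_trans X Y Z : gset_iso X Y -> gset_iso Y Z -> gset_iso X Z.
Proof.
move=> [f [fb fG]] [h [hb hG]]; exists (h \o f); split; first exact: bij_comp.
by move=> g x /=; rewrite fG hG.
Qed.

Lemma stab_act_eq X Y (x : X) (y : Y) : stabilizer x = stabilizer y ->
  forall a b, act a x = act b x -> act a y = act b y.
Proof.
move=> e a b ab; have : stabilizer x (b^-1 * a)%g.
  by rewrite /stabilizer /= actM ab actK.
by rewrite e /stabilizer /= actM => /(congr1 (act b)); rewrite actKV.
Qed.

Lemma orbit_iso X Y (x : X) (y : Y) : stabilizer x = stabilizer y ->
  gset_iso (orbit_gset (orbit_of x)) (orbit_gset (orbit_of y)).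
Proof.
have D X' Y' (x' : X') (y' : Y') : stabilizer x' = stabilizer y' ->
   { f : orbit_gset (orbit_of x') -> orbit_gset (orbit_of y') |
     forall u a, act a x' = val u -> val (f u) = act a y' }.
  move=> e.
  have gE (u : orbit_gset (orbit_of x')) : {g | act g x' = val u}.
    by case: u => u ux; apply: cid; case: (set_mem ux) => g _ gu; exists g.
  exists (fun u => SigSub (mem_set (ex_intro2 _ _ (projT1 (gE u)) I erefl))).
  move=> u a au /=; case: (gE u) => g gu /=; apply: (stab_act_eq e).
  by rewrite gu.
move=> e; have [f fE] := D _ _ _ _ e; have [h hE] := D _ _ _ _ (esym e).
exists f; split.
  exists h => -[u uP]; apply: val_inj; case: (set_mem uP) => a _ au /=.
    by rewrite (hE _ a) ?au // (fE _ a).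
  by rewrite (fE _ a) ?au // (hE _ a).
move=> g [u uP]; apply: val_inj; case: (set_mem uP) => a _ au /=.
by rewrite (fE _ (g * a)%g) ?actM ?au // (fE _ a).
Qed.

Lemma orbit_gset_transitive X (x : X) :
  gset_transitive (orbit_gset (orbit_of x)).
Proof.
exists (SigSub (mem_set (orbit_refl x))); rewrite -subTset => -[u uP] _.
case: (set_mem uP) => g _ gu; exists g => //.
by apply: val_inj.
Qed.

Lemma orbit_gset_stab X (O : orbits X) (u : orbit_gset O) :
  stabilizer u = stabilizer (val u : X).
Proof.
rewrite predeqE => g; split; first by move=> /(congr1 val).
by move=> gu; apply: val_inj.
Qed.

Lemma orbit_gset_smooth X (O : orbits X) :
  smooth Om X -> smooth Om (orbit_gset O).
Proof. by move=> Xs u; rewrite orbit_gset_stab. Qed.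

Lemma orbits_ind X (P : orbits X -> Prop) :
  (forall x, P (orbit_of x)) -> forall O, P O.
Proof.
move=> H [O OX]; have [x _ xO] := set_mem OX.
suff -> : exist _ O OX = orbit_of x by [].
by apply: val_inj.
Qed.

Lemma transitive_iso X (x : X) : orbit x = setT ->
  gset_iso X (orbit_gset (orbit_of x)).
Proof.
move=> xT; have xP u : u \in orbit x by rewrite xT in_setT.
exists (fun u => SigSub (xP u)); split; last first.
  by move=> g u; apply: val_inj.
by exists val => // u; apply: val_inj.
Qed.

Lemma smooth_tuple X (x : X) : smooth Om X ->
  exists s : seq_gset Om, stabilizer x = stabilizer s.
Proof.
move=> /(_ x) [A Af ->].
have [s ->] := (finite_seqP (A : set {classic Om})).1 Af.
exists s; rewrite predeqE => g; split.
  by move=> gs; apply: (@map_id_in {classic Om}) => a /gs.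
move=> /= gs a /= sa; have [] := (@eq_in_map {classic Om} _ (act g) id s).
by rewrite map_id => _ /(_ gs) /(_ a sa).
Qed.

Lemma smooth_seq : smooth Om (seq_gset Om).
Proof.
move=> s; exists ([set` (s : seq {classic Om})] : set {classic Om}).
  exact: (@finite_seq {classic Om} s).
rewrite predeqE => g; split; last first.
  by move=> gs; apply: (@map_id_in {classic Om}) => a /gs.
move=> /= gs a /= sa; have [] := (@eq_in_map {classic Om} _ (act g) id s).
by rewrite map_id => _ /(_ gs) /(_ a sa).
Qed.

Lemma iso_class_neq0 X : gset_transitive X -> smooth Om X ->
  iso_class X !=set0.
Proof.
move=> [x xT] Xs; have [s xs] := smooth_tuple x Xs; exists s.
exact: iso_trans (transitive_iso xT) (orbit_iso xs).
Qed.

Lemma iso_class_eq X Y : gset_iso X Y -> iso_class X = iso_class Y.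
Proof.
move=> XY; rewrite predeqE => s; split; last exact: iso_trans.
exact/iso_trans/iso_sym.
Qed.

Lemma iso_classP X Y : gset_transitive X -> smooth Om X ->
  iso_class X = iso_class Y <-> gset_iso X Y.
Proof.
move=> Xt Xs; split=> [XY|]; last exact: iso_class_eq.
have [s sX] := iso_class_neq0 Xt Xs; apply: (iso_trans sX).
by apply: iso_sym; move: sX; rewrite /iso_class -/(iso_class _) XY.
Qed.

Lemma transitive_class_eq X Y : gset_iso X Y ->
  transitive_class X = transitive_class Y.
Proof. by move=> XY; rewrite /transitive_class (iso_class_eq XY). Qed.

Lemma class_repP (k : transitive_classes) :
  [/\ gset_transitive (class_rep k), smooth Om (class_rep k)
    & iso_class (class_rep k) = val k].
Proof. by rewrite /class_rep; case: cid. Qed.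

Lemma transitive_class_rep k : transitive_class (class_rep k) = << k >>.
Proof.
rewrite /transitive_class; have [_ _ ->] := class_repP k.
by rewrite valK.
Qed.

Lemma transitive_classE X : gset_transitive X -> smooth Om X ->
  exists2 k, transitive_class X = << k >> & gset_iso X (class_rep k).
Proof.
move=> Xt Xs; have kP : iso_class X \in transitive_classes.
  by apply: mem_set; exists X.
exists (SigSub kP); first by rewrite /transitive_class insubT.
by apply/iso_classP => //; have [_ _ ->] := class_repP (SigSub kP).
Qed.

Definition transversal X (I : finType) (r : I -> X) : Prop :=
  (forall x, exists i, orbit (r i) x) /\
  (forall i j, orbit (r i) (r j) -> i = j).

Definition fin_orbits X : Prop :=
  exists (n : nat) (r : 'I_n -> X), transversal r.

Lemma gset_class_transversal X (I : finType) (r : I -> X) : transversal r ->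
  gset_class X = \sum_i transitive_class (orbit_gset (orbit_of (r i))).
Proof.
move=> [rc ri]; rewrite /gset_class.
have rb : bijective (fun i => orbit_of (r i)).
  rewrite -setTT_bijective; split=> //.
    move=> i j _ _ /(congr1 val) /= e; apply: ri; rewrite e.
    exact: orbit_refl.
  move=> + _; apply: orbits_ind => x; have [i ix] := rc x; exists i => //.
  by apply: val_inj; apply: orbit_eq.
rewrite (reindex_fsbigT (fun i => orbit_of (r i)) _ rb) /=.
rewrite (fsbigE (enum I)) ?enum_uniq //=.
  by rewrite big_enum_cond; apply: eq_bigl => i; rewrite in_setT.
by move=> i _; rewrite mem_enum.
Qed.

Lemma transversal_fin X (I : finType) (r : I -> X) :
  transversal r -> fin_orbits X.
Proof.
move=> [rc ri]; exists #|I|, (fun i => r (enum_val i)); split.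
  by move=> x; have [i ix] := rc x; exists (enum_rank i); rewrite enum_rankK.
by move=> i j /ri /enum_val_inj.
Qed.

Lemma cover_fin X (I : finType) (inv : X -> I -> Prop) :
  (forall x, exists i, inv x i) ->
  (forall x y i, inv x i -> inv y i -> orbit x y) -> fin_orbits X.
Proof.
move=> invT invP.
pose good i := `[< exists x, inv x i >].
have gP (i : {i | good i}) : {x | inv x (val i)}.
  by case: i => i /= /asboolP /cid.
pose r i := projT1 (gP i).
have rP i : inv (r i) (val i) by rewrite /r; case: (gP i).
have rc x : exists i, orbit (r i) x.
  have [i ix] := invT x; have ig : good i by apply/asboolP; exists x.
  by exists (exist _ i ig); apply: (invP _ _ _ (rP (exist _ i ig)) ix).
pose least i := [forall j : {i | good i},
  (enum_rank j < enum_rank i)%N ==> ~~ `[< orbit (r j) (r i) >]].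
apply: (@transversal_fin _ {i | least i} (fun i => r (val i))); split.
  move=> x; have [i0 i0x] := rc x.
  pose P i := `[< orbit (r i) x >].
  have Pi0 : P i0 by apply/asboolP.
  case: (arg_minnP (fun i => nat_of_ord (enum_rank i)) Pi0) => i /asboolP ix imin.
  have li : least i.
    apply/forallP => j; apply/implyP => ji; apply/asboolPn => jx.
    suff /imin : P j by rewrite leqNgt ji.
    by apply/asboolP; rewrite (orbit_eq jx).
  by exists (exist _ i li).
move=> [i li] [j lj] /= ij; apply: val_inj => /=.
have ji : orbit (r j) (r i) by rewrite -(orbit_eq ij); apply: orbit_refl.
case: (ltngtP (enum_rank i) (enum_rank j)) => [lt|lt|/val_inj/enum_rank_inj //].
  by move/forallP: lj => /(_ i) /implyP /(_ lt) /asboolP.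
by move/forallP: li => /(_ j) /implyP /(_ lt) /asboolP.
Qed.

Lemma transversal_iso X Y (f : X -> Y) (I : finType) (r : I -> X) :
  bijective f -> (forall g x, f (act g x) = act g (f x)) ->
  transversal r -> transversal (f \o r).
Proof.
move=> [f' fK f'K] fG rT.
have fo x y : orbit (f x) (f y) <-> orbit x y.
  split=> -[g _ e]; exists g => //; last by rewrite -fG e.
  by apply: (can_inj fK); rewrite fG.
split=> [y|i j /fo]; last exact: rT.2.
by have [i ix] := rT.1 (f' y); exists i; rewrite -[y]f'K; apply/fo.
Qed.

Lemma fin_orbits_iso X Y : gset_iso X Y -> fin_orbits X -> fin_orbits Y.
Proof.
by move=> [f [fb fG]] [n [r rT]]; exists n, (f \o r); apply: transversal_iso.
Qed.

Lemma gset_class_iso X Y : fin_orbits X -> gset_iso X Y ->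
  gset_class X = gset_class Y.
Proof.
move=> [n [r rT]] [f [fb fG]].
have fT := transversal_iso fb fG rT.
rewrite (gset_class_transversal rT) (gset_class_transversal fT).
apply: eq_bigr => i _; apply: transitive_class_eq; apply: orbit_iso.
rewrite predeqE => g; split=> /= [e|]; first by rewrite /stabilizer /= -fG e.
by rewrite /stabilizer /= -fG => /(bij_inj fb).
Qed.

Lemma transitive_transversal X (x : X) : orbit x = setT ->
  transversal (fun _ : unit => x).
Proof. by move=> xT; split=> [y|[] []] //; exists tt; rewrite xT. Qed.

Lemma gset_class_transitive X : gset_transitive X ->
  gset_class X = transitive_class X.
Proof.
move=> [x xT]; rewrite (gset_class_transversal (transitive_transversal xT)).
rewrite big_const card_unit /= addr0; apply/esym/transitive_class_eq.
exact: transitive_iso.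
Qed.

Lemma fglift_sum (M : lmodType int) (f : transitive_classes -> M)
  (I : Type) (l : seq I) (F : I -> burnside) :
  fglift f (\sum_(i <- l) F i) = \sum_(i <- l) fglift f (F i).
Proof.
have fB := lift_is_additive f.
have f0 : fglift f 0 = 0 by rewrite -(subrr 0) fB subrr.
have fD : {morph fglift f : x y / x + y}.
  by move=> x y; rewrite -[y in LHS]opprK -[- y]sub0r !fB f0 sub0r opprK.
by elim/big_rec2: _ => [|i y x _ <-]; rewrite ?fD.
Qed.

Lemma burnside_mulDl : left_distributive burnside_mul +%R.
Proof.
move=> x y z; rewrite /burnside_mul.
have := @fglift_sum burnside (fun i => fglift (fun j =>
    gset_class (prod_gset (class_rep i) (class_rep j))) z) _ [:: x; y] id.
by rewrite !big_cons !big_nil !addr0.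
Qed.

Lemma fgliftE (M : lmodType int) (f : transitive_classes -> M) (x : burnside) :
  fglift f x = \sum_(k <- dom x) coeff k x *: f k.
Proof.
by rewrite -{1}[x]freeg_sumE fglift_sum; apply: eq_bigr => k _; rewrite liftU.
Qed.

Lemma burnside_mulU i j : burnside_mul << i >> << j >> =
  gset_class (prod_gset (class_rep i) (class_rep j)).
Proof. by rewrite /burnside_mul !liftU !scale1r. Qed.

Lemma burnside_ind (P : burnside -> Prop) : P 0 ->
  (forall x y, P x -> P y -> P (x - y)) -> (forall k, P << k >>) ->
  forall x, P x.
Proof.
move=> P0 PB PU x; have PN y : P y -> P (- y).
  by move=> Py; rewrite -[- y]sub0r; apply: PB.
have PD y z : P y -> P z -> P (y + z).
  by move=> Py Pz; rewrite -[z]opprK; apply/PB/PN.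
have Pn y n : P y -> P (y *+ n).
  by move=> Py; elim: n => [|n Pn]; rewrite ?mulr0n ?mulrS //; apply: PD.
rewrite -[x]freeg_sumE; elim/big_ind: _ => // k _.
have -> : << coeff k x *g k >> = << k >> *~ coeff k x :> burnside.
  by rewrite freegU_mulz intz.
by case: (coeff k x) => n; rewrite ?NegzE ?mulrNz; [|apply: PN]; apply: Pn.
Qed.

Lemma smooth_prod X Y : smooth Om X -> smooth Om Y ->
  smooth Om (prod_gset X Y).
Proof.
move=> Xs Ys [x y]; have [A Af xA] := Xs x; have [B Bf yB] := Ys y.
exists (A `|` B); first by rewrite finite_setU.
rewrite predeqE => g; split=> [[gx gy] a [Aa|Ba]|gAB].
- by have : stabilizer x g by []; rewrite xA; apply.
- by have : stabilizer y g by []; rewrite yB; apply.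
- congr pair.
    by have : stabilizer x g by rewrite xA => a Aa; apply: gAB; left.
  by have : stabilizer y g by rewrite yB => a Aa; apply: gAB; right.
Qed.

(* Finitely many orbits on each power of [Om]. *)
Hypothesis Om_oligo : forall n, exists (I : finType) (d : I -> seq Om),
  forall s : seq Om, size s = n -> exists i g, map (act g) s = d i.

Lemma fin_orbits_prod_orbit X Y (x : X) (y : Y) :
  smooth Om X -> smooth Om Y ->
  fin_orbits (prod_gset (orbit_gset (orbit_of x)) (orbit_gset (orbit_of y))).
Proof.
move=> Xs Ys; have [s xs] := smooth_tuple x Xs; have [t yt] := smooth_tuple y Ys.
have [I [d dP]] := Om_oligo (size s + size t)%N.
pose inv (z : prod_gset (orbit_gset (orbit_of x)) (orbit_gset (orbit_of y))) i :=
  exists k g h, [/\ val z.1 = act g x, val z.2 = act h y &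
    map (act k) (map (act g) s ++ map (act h) t) = d i].
apply: (@cover_fin _ I inv).
  move=> [[u uP] [v vP]]; case: (set_mem uP) => g _ gu.
  case: (set_mem vP) => h _ hv.
  have [|i [k kE]] := dP (map (act g) s ++ map (act h) t).
    by rewrite size_cat !size_map.
  by exists i, k, g, h.
move=> [u v] [u' v'] i [k [g [h [/= gu hv e]]]] [k' [g' [h' [/= gu' hv' e']]]].
move: e; rewrite -e' !map_cat => e.
have es : act (k * g)%g (s : seq_gset Om) = act (k' * g')%g (s : seq_gset Om).
  rewrite !actM /=; move/(congr1 (take (size s))): e.
  by rewrite !take_size_cat ?size_map.
have et : act (k * h)%g (t : seq_gset Om) = act (k' * h')%g (t : seq_gset Om).
  rewrite !actM /=; move/(congr1 (drop (size s))): e.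
  by rewrite !drop_size_cat ?size_map.
have ex := stab_act_eq (esym xs) es; have ey := stab_act_eq (esym yt) et.
exists (k'^-1 * k)%g => //=; congr pair; apply: val_inj => /=.
  by rewrite gu gu' -actM -mulgA actM ex actM actK.
by rewrite hv hv' -actM -mulgA actM ey actM actK.
Qed.

Lemma prod_iso X X' Y Y' : gset_iso X X' -> gset_iso Y Y' ->
  gset_iso (prod_gset X Y) (prod_gset X' Y').
Proof.
move=> [f [[f' fK f'K] fG]] [h [[h' hK h'K] hG]].
exists (fun z => (f z.1, h z.2)); split; last first.
  by move=> g [x y]; rewrite /= fG hG.
by exists (fun z => (f' z.1, h' z.2)) => -[x y] /=; rewrite ?fK ?hK ?f'K ?h'K.
Qed.

Lemma fin_orbits_prod_transitive X Y :
  gset_transitive X -> gset_transitive Y -> smooth Om X -> smooth Om Y ->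
  fin_orbits (prod_gset X Y).
Proof.
move=> [x xT] [y yT] Xs Ys; have := fin_orbits_prod_orbit x y Xs Ys.
by apply/fin_orbits_iso/prod_iso; apply/iso_sym/transitive_iso.
Qed.

Lemma burnside_mulC : commutative burnside_mul.
Proof.
move=> x y; rewrite /burnside_mul !fgliftE.
under eq_bigr do rewrite fgliftE scaler_sumr.
rewrite exchange_big /=; apply: eq_bigr => j _.
rewrite fgliftE scaler_sumr; apply: eq_bigr => i _.
rewrite !scalerA mulrC; congr (_ *: _).
have [ti si _] := class_repP i; have [tj sj _] := class_repP j.
apply: gset_class_iso; first exact: fin_orbits_prod_transitive.
exists (fun z => (z.2, z.1)); split=> //.
by exists (fun z => (z.2, z.1)) => -[? ?].
Qed.

Lemma burnside_mul_suml (I : Type) (l : seq I) (F : I -> burnside) y :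
  burnside_mul (\sum_(i <- l) F i) y = \sum_(i <- l) burnside_mul (F i) y.
Proof. exact: fglift_sum. Qed.

Lemma burnside_mul_sumr (I : Type) (l : seq I) (F : I -> burnside) y :
  burnside_mul y (\sum_(i <- l) F i) = \sum_(i <- l) burnside_mul y (F i).
Proof.
by rewrite burnside_mulC burnside_mul_suml; under eq_bigr do rewrite burnside_mulC.
Qed.

Lemma gset_class_prod_subproof X Y : smooth Om X -> smooth Om Y ->
  fin_orbits X -> fin_orbits Y ->
  fin_orbits (prod_gset X Y) /\
  gset_class (prod_gset X Y) = burnside_mul (gset_class X) (gset_class Y).
Proof.
move=> Xs Ys [m [r [rc ri]]] [n [t [tc ti]]].
pose O i := orbit_gset (orbit_of (r i)); pose P j := orbit_gset (orbit_of (t j)).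
have OPf (ij : 'I_m * 'I_n) :
    { n : nat & {w : 'I_n -> prod_gset (O ij.1) (P ij.2) | transversal w}}.
  have /cid[k /cid[w wT]] := fin_orbits_prod_orbit (r ij.1) (t ij.2) Xs Ys.
  by exists k, w.
pose K ij := projT1 (OPf ij); pose w ij : 'I_(K ij) -> _ := projT1 (projT2 (OPf ij)).
have wT ij : transversal (w ij) by exact: (projT2 (projT2 (OPf ij))).
pose emb ij (z : prod_gset (O ij.1) (P ij.2)) : prod_gset X Y := (val z.1, val z.2).
pose W (u : {ij : 'I_m * 'I_n & 'I_(K ij)}) := emb _ (w _ (tagged u)).
have embo ij z z' : orbit z z' <-> orbit (emb ij z) (emb ij z').
  split=> -[g _ e]; exists g => //; first by rewrite -e.
  case: z z' e => [a b] [a' b'] /= [ea eb].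
  by congr pair; apply: val_inj.
have WT : transversal W.
  split.
    move=> [x y]; have [i [g _ gx]] := rc x; have [j [h _ hy]] := tc y.
    have xP : x \in orbit (r i) by apply: mem_set; exists g.
    have yP : y \in orbit (t j) by apply: mem_set; exists h.
    pose z : prod_gset (O (i, j).1) (P (i, j).2) := (SigSub xP, SigSub yP).
    have [k kz] := (wT (i, j)).1 z.
    exists (existT (fun ij => 'I_(K ij)) (i, j) k).
    exact: ((embo (i, j) _ _).1 kz).
  move=> [ij k] [ij' k'] kk'.
  have e : ij = ij'.
    case: ij ij' k k' kk' => [i j] [i' j'] k k' /=; rewrite /W /emb /=.
    case: (w _ k) (w _ k') => [[a aP] [b bP]] [[a' aP'] [b' bP']] /= [g _ [ga gb]].
    congr pair; first exact: ri (orbit_meet (set_mem aP) (set_mem aP') ga).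
    exact: ti (orbit_meet (set_mem bP) (set_mem bP') gb).
  case: _ / e k' kk' => k' kk'.
  congr existT; apply: (wT ij).2; apply/embo; exact: kk'.
split; first exact: transversal_fin WT.
have [rT tT] : transversal r /\ transversal t by [].
rewrite (gset_class_transversal WT) (gset_class_transversal rT).
rewrite (gset_class_transversal tT) burnside_mul_suml.
under [RHS]eq_bigr do rewrite burnside_mul_sumr.
rewrite pair_bigA /= -(@sig_big_dep _ _ _ _ (fun ij => 'I_(K ij)) xpredT (fun _ _ => true)
  (fun ij k =>
  transitive_class (orbit_gset (orbit_of (W (existT _ ij k)))))) /=.
apply: eq_bigr => ij _.
have Ot i : gset_transitive (O i) by exact: orbit_gset_transitive.
have Pt j : gset_transitive (P j) by exact: orbit_gset_transitive.
have Os i : smooth Om (O i) by exact: orbit_gset_smooth.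
have Ps j : smooth Om (P j) by exact: orbit_gset_smooth.
have [i -> Oi] := transitive_classE (Ot ij.1) (Os ij.1).
have [j -> Pj] := transitive_classE (Pt ij.2) (Ps ij.2).
rewrite burnside_mulU -(gset_class_iso _ (prod_iso Oi Pj)); last first.
  exact: fin_orbits_prod_transitive.
rewrite (gset_class_transversal (wT ij)); apply: eq_bigr => k _.
apply/transitive_class_eq/orbit_iso; rewrite predeqE => g.
rewrite /stabilizer /W /emb /=; case: (w _ k) => [a b] /=.
split=> [[ea eb]|[ea eb]].
  by congr pair; apply: val_inj.
by rewrite -[in RHS]ea -[in RHS]eb.
Qed.

Lemma fin_orbits_prod X Y : smooth Om X -> smooth Om Y ->
  fin_orbits X -> fin_orbits Y -> fin_orbits (prod_gset X Y).
Proof. by move=> Xs Ys Xf Yf; have [] := gset_class_prod_subproof Xs Ys Xf Yf. Qed.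

Lemma gset_class_prod X Y : smooth Om X -> smooth Om Y ->
  fin_orbits X -> fin_orbits Y ->
  gset_class (prod_gset X Y) = burnside_mul (gset_class X) (gset_class Y).
Proof. by move=> Xs Ys Xf Yf; have [] := gset_class_prod_subproof Xs Ys Xf Yf. Qed.

Lemma burnside_mulBl x y z :
  burnside_mul (x - y) z = burnside_mul x z - burnside_mul y z.
Proof. exact: lift_is_additive. Qed.

Lemma burnside_mulBr x y z :
  burnside_mul x (y - z) = burnside_mul x y - burnside_mul x z.
Proof. by rewrite burnside_mulC burnside_mulBl !(burnside_mulC x). Qed.

Lemma burnside_mul0x x : burnside_mul 0 x = 0.
Proof. by have := burnside_mulBl 0 0 x; rewrite !subrr. Qed.

Lemma burnside_mulx0 x : burnside_mul x 0 = 0.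
Proof. by rewrite burnside_mulC burnside_mul0x. Qed.

Lemma transitive_fin_orbits X : gset_transitive X -> fin_orbits X.
Proof. by move=> [x xT]; apply: transversal_fin (transitive_transversal xT). Qed.

Lemma class_rep_fin k : fin_orbits (class_rep k).
Proof. by apply: transitive_fin_orbits; have [] := class_repP k. Qed.

Lemma class_rep_smooth k : smooth Om (class_rep k).
Proof. by have [] := class_repP k. Qed.

Lemma gset_class_rep k : gset_class (class_rep k) = << k >>.
Proof.
rewrite gset_class_transitive ?transitive_class_rep //.
by have [] := class_repP k.
Qed.

Lemma burnside_mulA : associative burnside_mul.
Proof.
move=> x y z; elim/burnside_ind: x => [|x x' IH IH'|i].
- by rewrite !burnside_mul0x.
- by rewrite !burnside_mulBl IH IH'.
elim/burnside_ind: y => [|y y' IH IH'|j].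
- by rewrite burnside_mul0x burnside_mulx0 burnside_mul0x.
- by rewrite burnside_mulBl !burnside_mulBr burnside_mulBl IH IH'.
elim/burnside_ind: z => [|z z' IH IH'|k].
- by rewrite !burnside_mulx0.
- by rewrite !burnside_mulBr IH IH'.
have s := class_rep_smooth; have f := class_rep_fin.
have sp k1 k2 := smooth_prod (s k1) (s k2).
have fp k1 k2 := fin_orbits_prod (s k1) (s k2) (f k1) (f k2).
rewrite !burnside_mulU -!gset_class_rep -!gset_class_prod //.
- apply: gset_class_iso; first exact: fin_orbits_prod.
  exists (fun u => (u.1, u.2.1, u.2.2)); split=> //.
  by exists (fun u => (u.1.1, (u.1.2, u.2))) => [[? []]|[[]]].
Qed.

Lemma unit_gset_transitive : gset_transitive (unit_gset G).
Proof.
exists tt; rewrite -subTset => -[] _; exact: orbit_refl.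
Qed.

Lemma unit_gset_smooth : smooth Om (unit_gset G).
Proof.
move=> -[]; exists set0; first exact: finite_set0.
by rewrite predeqE => g; split=> [_ a []|_]; rewrite /stabilizer.
Qed.

Lemma burnside_mul1x : left_id burnside_one burnside_mul.
Proof.
elim/burnside_ind => [|x x' IH IH'|k].
- by rewrite burnside_mulx0.
- by rewrite burnside_mulBr IH IH'.
rewrite -gset_class_rep /burnside_one -gset_class_prod.
- apply: gset_class_iso.
    apply: fin_orbits_prod; do ?exact: class_rep_smooth; do ?exact: class_rep_fin.
      exact: unit_gset_smooth.
    exact/transitive_fin_orbits/unit_gset_transitive.
  by exists snd; split=> //; exists (fun u => (tt, u)) => // -[[]].
- exact: unit_gset_smooth.
- exact: class_rep_smooth.
- exact/transitive_fin_orbits/unit_gset_transitive.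
- exact: class_rep_fin.
Qed.

Lemma burnside_one_neq0 : burnside_one != 0.
Proof.
rewrite /burnside_one gset_class_transitive; last exact: unit_gset_transitive.
have [k -> _] := transitive_classE unit_gset_transitive unit_gset_smooth.
by rewrite freegU_eq0.
Qed.

End Burnside.

Arguments transitive_classes {G} Om.
Arguments gset_class {G} Om X.
Arguments transitive_class {G} Om X.

Section Away.
Variables (R : comNzRingType) (r : R).
Local Open Scope quotient_scope.

(* [(a, m)] stands for [a / r ^+ m]. *)
Definition away_eq (x y : R * nat) : bool :=
  `[< exists k, r ^+ k * (x.1 * r ^+ y.2) = r ^+ k * (y.1 * r ^+ x.2) >].

Lemma away_eq_refl : reflexive away_eq.
Proof. by move=> x; apply/asboolP; exists 0%N. Qed.

Lemma away_eq_sym : symmetric away_eq.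
Proof. by move=> x y; apply/asboolP/asboolP => -[k e]; exists k. Qed.

Lemma away_eq_trans : transitive away_eq.
Proof.
move=> [b n] [a m] [c p] /asboolP [k /= e] /asboolP [l /= e'].
apply/asboolP; exists (k + l + n)%N => /=; rewrite !exprD.
transitivity (r ^+ l * r ^+ p * (r ^+ k * (a * r ^+ n))); first by ring.
rewrite e; transitivity (r ^+ k * r ^+ m * (r ^+ l * (b * r ^+ p))); first by ring.
by rewrite e'; ring.
Qed.

Canonical away_equiv := EquivRel away_eq away_eq_refl away_eq_sym away_eq_trans.
Definition away := {eq_quot away_eq}.
HB.instance Definition _ := Choice.on away.
HB.instance Definition _ := EqQuotient.on away.

Definition away_frac (a : R) (m : nat) : away := \pi_away (a, m).

Lemma away_fracP a m b n : away_frac a m = away_frac b n <->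
  exists k, r ^+ k * (a * r ^+ n) = r ^+ k * (b * r ^+ m).
Proof. by split=> [/eqmodP/asboolP|e]; [|apply/eqmodP/asboolP]. Qed.

Lemma away_frac_eq a m b n :
  a * r ^+ n = b * r ^+ m -> away_frac a m = away_frac b n.
Proof. by move=> e; apply/away_fracP; exists 0%N; rewrite e. Qed.

Lemma away_ind (P : away -> Prop) :
  (forall a m, P (away_frac a m)) -> forall x, P x.
Proof. by move=> H; elim/quotW => -[a m]; apply: H. Qed.

Definition away_add (x y : away) : away :=
  away_frac ((repr x).1 * r ^+ (repr y).2 + (repr y).1 * r ^+ (repr x).2)
    ((repr x).2 + (repr y).2).

Definition away_opp (x : away) : away := away_frac (- (repr x).1) (repr x).2.

Definition away_mul (x y : away) : away :=
  away_frac ((repr x).1 * (repr y).1) ((repr x).2 + (repr y).2).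

Lemma away_repr a m : exists k,
  r ^+ k * ((repr (away_frac a m)).1 * r ^+ m) =
  r ^+ k * (a * r ^+ (repr (away_frac a m)).2).
Proof.
by apply/away_fracP; rewrite {1}/away_frac -surjective_pairing reprK.
Qed.

Lemma away_addE a m b n : away_add (away_frac a m) (away_frac b n) =
  away_frac (a * r ^+ n + b * r ^+ m) (m + n).
Proof.
rewrite /away_add; have [k] := away_repr a m; have [l] := away_repr b n.
case: (repr _) => b' n'; case: (repr _) => a' m' /= eb ea.
apply/away_fracP; exists (k + l)%N; rewrite !exprD.
transitivity (r ^+ l * r ^+ n * r ^+ n' * (r ^+ k * (a' * r ^+ m)) +
  r ^+ k * r ^+ m * r ^+ m' * (r ^+ l * (b' * r ^+ n))); first by ring.
by rewrite ea eb; ring.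
Qed.

Lemma away_oppE a m : away_opp (away_frac a m) = away_frac (- a) m.
Proof.
rewrite /away_opp; have [k] := away_repr a m; case: (repr _) => a' m' /= e.
by apply/away_fracP; exists k; rewrite !mulNr !mulrN e.
Qed.

Lemma away_mulE a m b n : away_mul (away_frac a m) (away_frac b n) =
  away_frac (a * b) (m + n).
Proof.
rewrite /away_mul; have [k] := away_repr a m; have [l] := away_repr b n.
case: (repr _) => b' n'; case: (repr _) => a' m' /= eb ea.
apply/away_fracP; exists (k + l)%N; rewrite !exprD.
transitivity ((r ^+ k * (a' * r ^+ m)) * (r ^+ l * (b' * r ^+ n)));
  first by ring.
by rewrite ea eb; ring.
Qed.

Lemma away_addA : associative away_add.
Proof.
elim/away_ind=> a m; elim/away_ind=> b n; elim/away_ind=> c p.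
by rewrite !away_addE; apply: away_frac_eq; rewrite !exprD; ring.
Qed.

Lemma away_addC : commutative away_add.
Proof.
elim/away_ind=> a m; elim/away_ind=> b n.
by rewrite !away_addE; apply: away_frac_eq; rewrite !exprD; ring.
Qed.

Lemma away_add0x : left_id (away_frac 0 0) away_add.
Proof.
elim/away_ind=> a m; rewrite away_addE; apply: away_frac_eq.
by rewrite !exprD; ring.
Qed.

Lemma away_addNx : left_inverse (away_frac 0 0) away_opp away_add.
Proof.
elim/away_ind=> a m; rewrite away_oppE away_addE; apply: away_frac_eq.
by rewrite !exprD; ring.
Qed.

HB.instance Definition _ :=
  GRing.isZmodule.Build away away_addA away_addC away_add0x away_addNx.

Lemma away_mulA : associative away_mul.
Proof.
elim/away_ind=> a m; elim/away_ind=> b n; elim/away_ind=> c p.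
by rewrite !away_mulE; apply: away_frac_eq; rewrite !exprD; ring.
Qed.

Lemma away_mulC : commutative away_mul.
Proof.
elim/away_ind=> a m; elim/away_ind=> b n.
by rewrite !away_mulE; apply: away_frac_eq; rewrite !exprD; ring.
Qed.

Lemma away_mul1x : left_id (away_frac 1 0) away_mul.
Proof.
elim/away_ind=> a m; rewrite away_mulE; apply: away_frac_eq.
by rewrite !exprD; ring.
Qed.

Lemma away_mulDl : left_distributive away_mul away_add.
Proof.
elim/away_ind=> a m; elim/away_ind=> b n; elim/away_ind=> c p.
rewrite !(away_mulE, away_addE); apply: away_frac_eq.
by rewrite !exprD; ring.
Qed.

HB.instance Definition _ :=
  GRing.Zmodule_isComPzRing.Build away away_mulA away_mulC away_mul1x away_mulDl.

Definition to_away (a : R) : away := away_frac a 0.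

Lemma to_away_zmod_morphism : zmod_morphism to_away.
Proof.
move=> a b; apply: esym; rewrite -[LHS]/(away_add (to_away a) (away_opp (to_away b))).
by rewrite /to_away away_oppE away_addE; apply: away_frac_eq; ring.
Qed.

Lemma to_away_monoid_morphism : monoid_morphism to_away.
Proof.
by split=> // a b; rewrite /to_away [RHS]away_mulE.
Qed.

HB.instance Definition _ :=
  GRing.isZmodMorphism.Build R away to_away to_away_zmod_morphism.
HB.instance Definition _ :=
  GRing.isMonoidMorphism.Build R away to_away to_away_monoid_morphism.

Lemma away_fracE a m : away_frac a m * to_away r ^+ m = to_away a.
Proof.
by rewrite -rmorphXn [LHS]away_mulE addn0; apply: away_frac_eq; ring.
Qed.

Lemma away_frac_to_away a m : away_frac a m = to_away a * away_frac 1 m.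
Proof. by rewrite [RHS]away_mulE; apply: away_frac_eq; ring. Qed.

Lemma to_away_unit : to_away r * away_frac 1 1 = 1.
Proof. by rewrite mulrC -[to_away r]expr1 away_fracE. Qed.

End Away.

Record formed_space (F : fieldType) := FormedSpace {
  space :> lmodType F;
  sform : {biscalar space};
  sform_alt : forall x, sform x x = 0 }.
Arguments sform {F f}.

Section FormedSpaces.
Variable F : fieldType.
Implicit Types U W : formed_space F.

Definition isometric U W (phi : U -> W) : Prop :=
  forall x y, sform (phi x) (phi y) = sform x y.

Definition embeddings U W : set (U -> W) :=
  [set phi | [/\ linear phi, injective phi & isometric phi]].
Arguments embeddings U W : clear implicits.

Definition automorphisms W : set (W -> W) :=
  [set g | [/\ linear g, bijective g & isometric g]].
Arguments automorphisms W : clear implicits.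

Definition aut W := set_type (automorphisms W).
HB.instance Definition _ W := Choice.on (aut W).

Lemma aut_linear W (g : aut W) : linear (val g).
Proof. by case: (set_mem (valP g)). Qed.

Lemma aut_bij W (g : aut W) : bijective (val g).
Proof. by case: (set_mem (valP g)). Qed.

Lemma aut_isometric W (g : aut W) : isometric (val g).
Proof. by case: (set_mem (valP g)). Qed.

Lemma aut_id_subproof W : @id W \in automorphisms W.
Proof. by apply: mem_set; split=> //; exists id. Qed.

Lemma aut_comp_subproof W (g h : aut W) : val g \o val h \in automorphisms W.
Proof.
apply: mem_set; split=> [a x y||x y] /=.
- by rewrite !aut_linear.
- exact: bij_comp (aut_bij g) (aut_bij h).
- by rewrite !aut_isometric.
Qed.

Lemma aut_inv_ex W (g : aut W) :
  exists g' : W -> W, cancel (val g) g' /\ cancel g' (val g).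
Proof. by have [g' gK g'K] := aut_bij g; exists g'. Qed.

Definition aut_inv_fun W (g : aut W) : W -> W := projT1 (cid (aut_inv_ex g)).

Lemma aut_inv_funK W (g : aut W) : cancel (val g) (aut_inv_fun g).
Proof. by rewrite /aut_inv_fun; case: cid => ? []. Qed.

Lemma aut_inv_funKV W (g : aut W) : cancel (aut_inv_fun g) (val g).
Proof. by rewrite /aut_inv_fun; case: cid => ? []. Qed.

Lemma aut_inv_subproof W (g : aut W) : aut_inv_fun g \in automorphisms W.
Proof.
have K := aut_inv_funK g; have KV := aut_inv_funKV g.
apply: mem_set; split=> [a x y||x y].
- by apply: (can_inj K); rewrite aut_linear !KV.
- by exists (val g).
- by rewrite -(aut_isometric g) !KV.
Qed.

Definition aut_one W : aut W := SigSub (aut_id_subproof W).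
Definition aut_mul W (g h : aut W) : aut W := SigSub (aut_comp_subproof g h).
Definition aut_inv W (g : aut W) : aut W := SigSub (aut_inv_subproof g).

Lemma aut_mulA W : associative (@aut_mul W).
Proof. by move=> f g h; apply: val_inj. Qed.
Lemma aut_mul1 W : left_id (@aut_one W) (@aut_mul W).
Proof. by move=> g; apply: val_inj. Qed.
Lemma aut_mulg1 W : right_id (@aut_one W) (@aut_mul W).
Proof. by move=> g; apply: val_inj. Qed.
Lemma aut_mulV W : left_inverse (@aut_one W) (@aut_inv W) (@aut_mul W).
Proof. by move=> g; apply: val_inj; apply: funext => x /=; rewrite aut_inv_funK. Qed.
Lemma aut_mulgV W : right_inverse (@aut_one W) (@aut_inv W) (@aut_mul W).
Proof. by move=> g; apply: val_inj; apply: funext => x /=; rewrite aut_inv_funKV. Qed.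

HB.instance Definition _ W := isGroup.Build (aut W)
  (@aut_mulA W) (@aut_mul1 W) (@aut_mulg1 W) (@aut_mulV W) (@aut_mulgV W).

Definition aut_gset W : gset (aut W).
Proof. by refine (@GSet (aut W) W (fun g x => val g x) _ _). Defined.

Lemma embedding_comp_subproof U W (g : aut W) (phi : embeddings U W) :
  val g \o val phi \in embeddings U W.
Proof.
have [phiL phiI phiF] := set_mem (valP phi).
apply: mem_set; split=> [a x y||x y] /=.
- by rewrite phiL aut_linear.
- exact: inj_comp (bij_inj (aut_bij g)) phiI.
- by rewrite aut_isometric phiF.
Qed.

Definition embedding_gset U W : gset (aut W).
Proof.
refine (@GSet (aut W) (embeddings U W)
  (fun g phi => SigSub (embedding_comp_subproof g phi)) _ _).
- by move=> phi; apply: val_inj.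
- by move=> g h phi; apply: val_inj.
Defined.

End FormedSpaces.

Arguments embeddings {F} U W.
Arguments automorphisms {F} W.

Section StandardSpace.
Variables (F : fieldType) (m n : nat).

Definition std_carrier := ('rV[F]_m * 'rV[F]_m * 'rV[F]_n)%type.
HB.instance Definition _ := GRing.Lmodule.on std_carrier.

Definition std_form (x y : std_carrier) : F :=
  \sum_i (x.1.1 0 i * y.1.2 0 i - x.1.2 0 i * y.1.1 0 i).

Lemma std_form_bilinear : bilinear_for *%R *%R std_form.
Proof.
split=> u a x y; rewrite /std_form /= mulr_sumr -big_split /=;
  by apply: eq_bigr => i _; rewrite !mxE; ring.
Qed.

HB.instance Definition _ := bilinear_isBilinear.Build F
  std_carrier std_carrier F *%R *%R std_form std_form_bilinear.

Lemma std_form_alt x : std_form x x = 0.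
Proof. by rewrite /std_form big1 // => i _; ring. Qed.

Definition std_space : formed_space F := FormedSpace std_form_alt.
End StandardSpace.

Section InfiniteSpace.
Variable F : fieldType.

(* Polynomials serve as finitely supported sequences: the basis vectors [e_i]
   and [f_i] are [('X^i, 0)] and [(0, 'X^i)]. *)
Definition inf_carrier := ({poly F} * {poly F})%type.
HB.instance Definition _ := GRing.Lmodule.on inf_carrier.

Definition coef_dot (p q : {poly F}) : F := \sum_(i < size p) p`_i * q`_i.

Definition inf_form (x y : inf_carrier) : F :=
  coef_dot x.1 y.2 - coef_dot x.2 y.1.

Lemma coef_dotE N (p q : {poly F}) : (size p <= N)%N ->
  coef_dot p q = \sum_(i < N) p`_i * q`_i.
Proof.
move=> pN; rewrite /coef_dot (big_ord_widen N (fun i => p`_i * q`_i) pN).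
rewrite big_mkcond; apply: eq_bigr => i _; case: ltnP => // ip.
by rewrite nth_default ?mul0r.
Qed.

Lemma coef_dotC p q : coef_dot p q = coef_dot q p.
Proof.
rewrite (@coef_dotE (maxn (size p) (size q))) ?leq_maxl //.
rewrite (@coef_dotE (maxn (size p) (size q)) q) ?leq_maxr //.
by apply: eq_bigr => i _; rewrite mulrC.
Qed.

Lemma coef_dotPr p a q r :
  coef_dot p (a *: q + r) = a * coef_dot p q + coef_dot p r.
Proof.
rewrite /coef_dot mulr_sumr -big_split /=; apply: eq_bigr => i _.
by rewrite coefD coefZ; ring.
Qed.

Lemma coef_dotPl p a q r :
  coef_dot (a *: q + r) p = a * coef_dot q p + coef_dot r p.
Proof. by rewrite !(coef_dotC _ p) coef_dotPr. Qed.

Lemma inf_form_bilinear : bilinear_for *%R *%R inf_form.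
Proof.
split=> u a x y; rewrite /inf_form /= !(coef_dotPl, coef_dotPr); ring.
Qed.

HB.instance Definition _ := bilinear_isBilinear.Build F
  inf_carrier inf_carrier F *%R *%R inf_form inf_form_bilinear.

Lemma inf_form_alt x : inf_form x x = 0.
Proof. by rewrite /inf_form coef_dotC subrr. Qed.

Definition inf_space : formed_space F := FormedSpace inf_form_alt.

Definition inf_e (i : nat) : inf_space := ('X^i, 0).
Definition inf_f (i : nat) : inf_space := (0, 'X^i).

Lemma coef_dot0l p : coef_dot 0 p = 0.
Proof. by rewrite /coef_dot size_poly0 big_ord0. Qed.

Lemma coef_dotXn p i : coef_dot p 'X^i = p`_i.
Proof.
rewrite (@coef_dotE (maxn (size p) i.+1)) ?leq_maxl //.
have iN : (i < maxn (size p) i.+1)%N by rewrite leq_max leqnn orbT.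
rewrite (bigD1 (Ordinal iN)) //= coefXn eqxx mulr1 big1 ?addr0 // => j.
rewrite -val_eqE /= => ji; by rewrite coefXn (negbTE ji) mulr0.
Qed.

Lemma sform_ee i j : sform (inf_e i) (inf_e j) = 0.
Proof. by rewrite /sform /= /inf_form /= coef_dot0l coef_dotC coef_dot0l subrr. Qed.

Lemma sform_ff i j : sform (inf_f i) (inf_f j) = 0.
Proof. by rewrite /sform /= /inf_form /= coef_dot0l coef_dotC coef_dot0l subrr. Qed.

Lemma sform_ef i j : sform (inf_e i) (inf_f j) = (i == j)%:R.
Proof. by rewrite /sform /= /inf_form /= coef_dot0l subr0 coef_dotXn coefXn eq_sym. Qed.

End InfiniteSpace.

Section Transvections.
Variables (F : fieldType) (W : formed_space F).
Implicit Types x y u v : W.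

Lemma sform_skew x y : sform x y = - sform y x.
Proof.
have := sform_alt (x + y); rewrite linearDl !linearDr !sform_alt.
by rewrite add0r addr0 => /eqP; rewrite addr_eq0 => /eqP.
Qed.

Definition transvection u (c : F) x : W := x + (c * sform x u) *: u.

Lemma sform_transvection u c x : sform (transvection u c x) u = sform x u.
Proof. by rewrite linearDl linearZl_LR sform_alt mulr0 addr0. Qed.

Lemma transvectionK u c : cancel (transvection u c) (transvection u (- c)).
Proof.
move=> x; rewrite {1}/transvection sform_transvection -addrA -scalerDl.
by rewrite -mulrDl subrr mul0r scale0r addr0.
Qed.

Lemma transvection_aut_subproof u c : transvection u c \in automorphisms W.
Proof.
apply: mem_set; split=> [a x y||x y].
- rewrite /transvection linearPl mulrDr scalerDl scalerDr !scalerA.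
  by rewrite [a * (c * _)]mulrCA !addrA; congr (_ + _); rewrite -!addrA [y + _]addrC.
- exists (transvection u (- c)); first exact: transvectionK.
  by rewrite -{2}[c]opprK; apply: transvectionK.
rewrite /transvection linearDl !linearDr !linearZl_LR !linearZr_LR sform_alt.
by rewrite (sform_skew u y); ring.
Qed.

Definition transvection_aut u c : aut W := SigSub (transvection_aut_subproof u c).

Lemma aut_move1 x y : sform x y != 0 -> exists g : aut W, val g x = y.
Proof.
move=> xy; exists (transvection_aut (x - y) (sform x y)^-1) => /=.
rewrite /transvection linearBr sform_alt sub0r mulrN mulVf // scaleN1r.
by rewrite opprB addrC subrK.
Qed.

Lemma aut_move x y z : sform x z != 0 -> sform z y != 0 ->
  exists g : aut W, val g x = y.
Proof.
move=> /aut_move1 [g gx] /aut_move1 [h hz]; exists (h * g)%g => /=.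
by rewrite gx.
Qed.
End Transvections.

Section InfiniteOrbits.
Variable F : fieldType.
Local Notation V := (inf_space F).

Lemma inf_nondegenerate (x : V) : x != 0 -> exists z : V, sform x z != 0.
Proof.
case: x => p q; have [->|p0] := eqVneq p 0; last first.
  move=> _; exists (inf_f F (size p).-1).
  rewrite /sform /= /inf_form /= coef_dotXn coef_dotC coef_dot0l subr0.
  by rewrite -lead_coefE lead_coef_eq0.
have [->|q0 _] := eqVneq q 0; first by rewrite eqxx.
exists (inf_e F (size q).-1).
rewrite /sform /= /inf_form /= coef_dotXn coef_dot0l sub0r oppr_eq0.
by rewrite -lead_coefE lead_coef_eq0.
Qed.

Lemma inf_move (x y : V) : x != 0 -> y != 0 -> exists g : aut V, val g x = y.
Proof.
move=> /inf_nondegenerate [z xz] /inf_nondegenerate [t yt].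
have {}yt : sform t y != 0 by rewrite sform_skew oppr_eq0.
have [zy|] := eqVneq (sform z y) 0; last exact: aut_move.
have [xt|xt] := eqVneq (sform x t) 0; last exact: aut_move yt.
apply: (@aut_move _ _ x y (z + t)); rewrite ?linearDr ?linearDl.
  by rewrite xt addr0.
by rewrite zy add0r.
Qed.

(* [V] is the orthogonal sum of the plane of [e_0, f_0] and a copy of itself. *)
Definition inf_head (x : V) : V := (take_poly 1 x.1, take_poly 1 x.2).
Definition inf_tail (x : V) : V := (drop_poly 1 x.1, drop_poly 1 x.2).
Definition inf_shift (x : V) : V := (x.1 * 'X, x.2 * 'X).

Definition inf_ext (g : V -> V) (x : V) : V := inf_head x + inf_shift (g (inf_tail x)).

Lemma inf_head_tail x : inf_head x + inf_shift (inf_tail x) = x.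
Proof.
by case: x => p q; congr pair; rewrite /= -['X]expr1 poly_take_drop.
Qed.

Lemma inf_head_ext g x : inf_head (inf_ext g x) = inf_head x.
Proof.
congr pair; apply/polyP => i; rewrite /= !coef_take_poly;
  by case: i => [|i] //=; rewrite coefD coefMX coef_take_poly /= addr0.
Qed.

Lemma inf_tail_ext g x : inf_tail (inf_ext g x) = g (inf_tail x).
Proof.
rewrite [RHS]surjective_pairing; congr pair; apply/polyP => i;
  by rewrite /= coef_drop_poly addn1 coefD coefMX coef_take_poly /= add0r.
Qed.

Lemma inf_ext_comp g h x : inf_ext g (inf_ext h x) = inf_ext (g \o h) x.
Proof. by rewrite {1}/inf_ext inf_head_ext inf_tail_ext. Qed.

Lemma inf_ext_id g : g =1 id -> inf_ext g =1 id.
Proof. by move=> gE x; rewrite /inf_ext gE inf_head_tail. Qed.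

Lemma coef_dot_drop (p q : {poly F}) :
  coef_dot p q = p`_0 * q`_0 + coef_dot (drop_poly 1 p) (drop_poly 1 q).
Proof.
rewrite (@coef_dotE _ (size p).+1) // big_ord_recl.
rewrite (@coef_dotE _ (size p)); last by rewrite size_drop_poly leq_subr.
by congr (_ + _); apply: eq_bigr => i _; rewrite !coef_drop_poly addn1.
Qed.

Lemma sform_head_tail (x y : V) : sform x y =
  (x.1`_0 * y.2`_0 - x.2`_0 * y.1`_0) + sform (inf_tail x) (inf_tail y).
Proof.
rewrite /sform /= /inf_form /= (coef_dot_drop x.1) (coef_dot_drop x.2).
by rewrite opprD addrACA.
Qed.

Lemma inf_ext_coef0 g x :
  (inf_ext g x).1`_0 = x.1`_0 /\ (inf_ext g x).2`_0 = x.2`_0.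
Proof.
by rewrite /= !coefD !coefMX /= !addr0 !coef_take_poly.
Qed.

Lemma inf_ext_aut_subproof (g : aut V) : inf_ext (val g) \in automorphisms V.
Proof.
apply: mem_set; split=> [a x y||x y].
- have tl u v : inf_tail (a *: u + v) = a *: inf_tail u + inf_tail v.
    by congr pair; rewrite /= drop_polyD drop_polyZ.
  have hd u v : inf_head (a *: u + v) = a *: inf_head u + inf_head v.
    by congr pair; rewrite /= take_polyD take_polyZ.
  have sh u v : inf_shift (a *: u + v) = a *: inf_shift u + inf_shift v.
    by congr pair; rewrite /= mulrDl -scalerAl.
  by rewrite /inf_ext tl aut_linear sh hd scalerDr addrACA.
- exists (inf_ext (val (g^-1)%g)) => x; rewrite inf_ext_comp inf_ext_id // => y.
    exact: (aut_inv_funK g y).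
  exact: (aut_inv_funKV g y).
- rewrite [LHS]sform_head_tail [RHS]sform_head_tail !inf_tail_ext aut_isometric.
  by have [-> ->] := inf_ext_coef0 (val g) x; have [-> ->] := inf_ext_coef0 (val g) y.
Qed.

Definition inf_ext_aut (g : aut V) : aut V := SigSub (inf_ext_aut_subproof g).

Definition inf_le (n : nat) (x : V) : bool := (size x.1 <= n)%N && (size x.2 <= n)%N.

Lemma inf_ext_le g n x : inf_le n (g (inf_tail x)) -> inf_le n.+1 (inf_ext g x).
Proof.
have H (p q : {poly F}) : (size q <= n)%N -> (size (take_poly 1 p + q * 'X)%R <= n.+1)%N.
  move=> qn; apply: (leq_trans (size_polyD _ _)); rewrite geq_max.
  rewrite (leq_trans (size_take_poly _ _)) //=.
  by rewrite (leq_trans (size_polyMleq _ _)) // size_polyX addn2.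
by rewrite /inf_le => /andP[a b]; rewrite !H.
Qed.

Lemma inf_move_seq (s : seq V) :
  exists g : aut V, all (fun x => inf_le (size s) (val g x)) s.
Proof.
have [n] := ubnP (size s); elim: n s => // n IH [|x s] /= sn; first by exists 1%g.
have g0 (g : aut V) : val g 0 = 0.
  by have := aut_linear g (-1) 0 0; rewrite scaler0 addr0 scaleN1r addNr.
have [->|x0] := eqVneq x 0.
  have [g /allP gs] := IH s sn; exists g.
  rewrite g0 /inf_le /= size_poly0 /=; apply/allP => y /gs /andP[a b].
  by rewrite /inf_le !leqW.
have e0 : inf_e F 0 != 0.
  by apply/eqP => -[] /eqP; rewrite expr0 oner_eq0.
have [h hx] := inf_move x0 e0.
have [|g /allP gs] := IH [seq inf_tail (val h y) | y <- s]; first by rewrite size_map.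
exists (inf_ext_aut g * h)%g => /=; apply/andP; split.
  rewrite hx; apply: inf_ext_le.
  have -> : inf_tail (inf_e F 0) = 0.
    by congr pair; rewrite /= ?drop_poly_eq0 ?size_poly0 // expr0 size_poly1.
  by rewrite g0 /inf_le /= size_poly0.
apply/allP => y ys; apply: inf_ext_le.
by have := gs _ (map_f (fun y => inf_tail (val h y)) ys); rewrite size_map.
Qed.
End InfiniteOrbits.

Lemma inf_oligo (F : finFieldType) (n : nat) :
  exists (I : finType) (d : I -> seq (aut_gset (inf_space F))),
  forall s : seq (aut_gset (inf_space F)), size s = n ->
  exists i g, map (act g) s = d i.
Proof.
pose dec (x : n.-tuple F * n.-tuple F) : inf_space F := (Poly x.1, Poly x.2).
exists (n.-tuple (n.-tuple F * n.-tuple F))%type.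
exists (fun i : n.-tuple (n.-tuple F * n.-tuple F)%type => map dec (val i)).
move=> s sn; have [g /allP gs] := inf_move_seq s.
pose enc (x : inf_space F) : n.-tuple F * n.-tuple F :=
  (mktuple (fun i : 'I_n => x.1`_i), mktuple (fun i : 'I_n => x.2`_i)).
have tP : size [seq enc (val g x) | x <- s] == n by rewrite size_map sn.
exists (Tuple tP), g; rewrite /= -map_comp; apply/eq_in_map => x /gs.
rewrite /inf_le sn /= => /andP[a b].
have H (p : {poly F}) : (size p <= n)%N -> Poly (mktuple (fun i : 'I_n => p`_i)) = p.
  move=> pn; apply/polyP => i; rewrite coef_Poly; case: (ltnP i n) => ni.
    by rewrite -(nth_mktuple (fun i : 'I_n => p`_i) 0 (Ordinal ni)).
  by rewrite !nth_default ?size_tuple // (leq_trans pn).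
by rewrite /= /dec /enc /= !H //; case: (val g x).
Qed.

Section InfiniteSymplecticGroup.
Variable F : finFieldType.

Definition sp_gset : gset (aut (inf_space F)) := aut_gset (inf_space F).

Definition sp_burnside := burnside sp_gset.
HB.instance Definition _ := GRing.Zmodule.on sp_burnside.
HB.instance Definition _ := GRing.Zmodule_isComNzRing.Build sp_burnside
  (burnside_mulA (@inf_oligo F)) (burnside_mulC (@inf_oligo F))
  (burnside_mul1x (@inf_oligo F)) (@burnside_mulDl _ sp_gset)
  (@burnside_one_neq0 _ sp_gset).

Definition embedding_class (m n : nat) : sp_burnside :=
  gset_class sp_gset (embedding_gset (std_space F m n) (inf_space F)).

Lemma embedding_smooth m n :
  smooth sp_gset (embedding_gset (std_space F m n) (inf_space F)).
Proof.
move=> phi; exists (range (val phi)).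
  by apply: finite_image; apply: (@finite_finset ('rV[F]_m * 'rV[F]_m * 'rV[F]_n)%type).
rewrite predeqE => g; split=> [/(congr1 val) e _ [x _ <-]|gphi].
  exact: (congr1 (@^~ x) e).
by apply: val_inj; apply: funext => x; apply: gphi; exists x.
Qed.

Lemma embedding_fin_orbits m n :
  fin_orbits (embedding_gset (std_space F m n) (inf_space F)).
Proof.
pose E := enum {: 'rV[F]_m * 'rV[F]_m * 'rV[F]_n}.
have [I [d dP]] := @inf_oligo F (size E).
apply: (@cover_fin _ (embedding_gset (std_space F m n) (inf_space F)) I
  (fun phi i => exists k : aut (inf_space F),
  map (fun x => val k (val phi x)) E = d i)).
  move=> phi; have [|i [k e]] := dP (map (val phi) E); first by rewrite size_map.
  by exists i, k; rewrite -e /= -map_comp.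
move=> phi psi i [k <-] [l /eq_in_map e]; exists (l^-1 * k)%g => //.
apply: val_inj; apply: funext => x.
rewrite -[RHS](aut_inv_funK l).
exact: (congr1 (aut_inv_fun l) (esym (e x (mem_enum _ x)))).
Qed.

Definition Zinv := away (#|F|%:R : int).
HB.instance Definition _ := GRing.ComPzRing.on Zinv.

Lemma Zinv_oner_neq0 : (1 : Zinv) != 0.
Proof.
apply/eqP => /away_fracP [k] /eqP; rewrite !expr0 !mulr1 mulr0 expf_eq0.
by rewrite Num.Theory.pnatr_eq0 -cardsT (cardsD1 0) inE andbF.
Qed.
HB.instance Definition _ := GRing.PzSemiRing_isNonZero.Build Zinv Zinv_oner_neq0.

Definition sp_burnside_inv := away (#|F|%:R : sp_burnside).
HB.instance Definition _ := GRing.ComPzRing.on sp_burnside_inv.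

End InfiniteSymplecticGroup.

(* Main.v *)
(* For an alternating matrix [M] let [H(M)] be the class of the set of all families
   of vectors, not necessarily independent, with Gram matrix [M].  It depends only
   on the congruence class of [M], and [H(M) H(N)] is the sum of the classes of the
   block matrices with diagonal blocks [M] and [N].  Put [D = H(0)] for the 1 x 1
   zero matrix, so that [D = x_{0,1} + 1], and [X = H(h) = x_{1,0}] for the
   hyperbolic plane [h].

   Surjectivity.  Completing squares, [D H(M)] is a power of [q] times
   [H(0 + M)] plus classes of matrices of larger rank; and for [M] invertible of
   size [k] the products [X H(M)] and [D^2 H(M)] are combinations of [H(0 + M)] and
   [H(h + M)] ([0] being 2 x 2) from which [q ^ (3 k) H(h + M)] can be isolated.
   Hence every [H(M)] is a polynomial in [D] and [X] over [Z[1/q]].  By Witt's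
   theorem [H(M)] has exactly one orbit of independent families, the other orbits
   being orbits of shorter families, so all transitive classes are reached.

   Injectivity.  Counting the points fixed by the pointwise stabilizer of a
   subspace of dimension [K] and rank [r] is a ring morphism to [Z]; it sends [D]
   to [q ^ K] and [q X] to [q ^ (2 K) - q ^ (2 K - r)], and these points are
   Zariski dense in the plane. *)

Require Import Defs.
From HB Require Import structures.
From mathcomp Require Import all_boot all_order all_algebra.
From mathcomp Require Import boolp classical_sets cardinality freeg.
From mathcomp Require Import ring mpoly.
Import Defs.

Set Implicit Arguments.
Unset Strict Implicit.
Unset Printing Implicit Defensive.

Import GRing.Theory.
Local Open Scope ring_scope.

(** * Localization and polynomials in two variables *)

Section AwayLift.
Variables (R : comNzRingType) (r : R) (S : comPzRingType).
Variables (f : {rmorphism R -> S}) (u : S).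

Definition away_lift (x : away r) : S := f (repr x).1 * u ^+ (repr x).2.

Hypothesis fr : f r * u = 1.

(** Fractions are equal only up to a factor [r ^+ k]; since [u] is inverse to [f r], this factor
    cancels, so the value does not depend on the representative picked by [repr]. *)
Lemma away_liftE a m : away_lift (away_frac r a m) = f a * u ^+ m.
Proof.
have fru k : f r ^+ k * u ^+ k = 1 by rewrite -exprMn fr expr1n.
have [k] := away_repr r a m; rewrite /away_lift; case: (repr _) => b n /= e.
move/(congr1 (fun z => f z * (u ^+ k * u ^+ m * u ^+ n))): e.
rewrite !rmorphM !rmorphXn => e.
transitivity (f r ^+ k * u ^+ k * (f r ^+ m * u ^+ m) * (f b * u ^+ n)).
  by rewrite !fru !mul1r.
transitivity (f r ^+ k * u ^+ k * (f r ^+ n * u ^+ n) * (f a * u ^+ m)).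
  by apply: etrans (etrans e _); ring.
by rewrite !fru !mul1r.
Qed.

Lemma away_lift_zmod_morphism : zmod_morphism away_lift.
Proof.
have fru k : f r ^+ k * u ^+ k = 1 by rewrite -exprMn fr expr1n.
elim/away_ind=> a m; elim/away_ind=> b n.
rewrite -[_ - _]/(away_add _ (away_opp _)) away_oppE away_addE !away_liftE.
rewrite rmorphD !rmorphM rmorphN !rmorphXn exprD.
transitivity (f a * u ^+ m * (f r ^+ n * u ^+ n) -
  f b * u ^+ n * (f r ^+ m * u ^+ m)); first by ring.
by rewrite !fru !mulr1.
Qed.

Lemma away_lift_monoid_morphism : monoid_morphism away_lift.
Proof.
split; first by rewrite away_liftE rmorph1 mul1r.
elim/away_ind=> a m; elim/away_ind=> b n.
have -> : away_frac r a m * away_frac r b n = away_frac r (a * b) (m + n).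
  exact: away_mulE.
by rewrite !away_liftE rmorphM exprD; ring.
Qed.

Lemma away_universal : exists g : {rmorphism away r -> S},
  forall a m, g (away_frac r a m) = f a * u ^+ m.
Proof.
pose gA := GRing.isZmodMorphism.Build _ _ away_lift away_lift_zmod_morphism.
pose gM := GRing.isMonoidMorphism.Build _ _ away_lift away_lift_monoid_morphism.
pose g : {rmorphism away r -> S} := HB.pack away_lift gA gM.
by exists g => a m; apply: away_liftE.
Qed.
End AwayLift.

(** * Zariski density for polynomials in two variables *)

Section Density.
Variables (R : comNzRingType) (T : idomainType) (iota : {rmorphism R -> T}).

(** Regard [p] as a polynomial in the first variable over polynomials in the second. At each [y] in
    [ys] it has too many roots [xs], which may depend on [y]; hence each of its coefficients has all
    of [ys] as roots and vanishes too. *)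
Lemma mpoly2_eq0 (p : {mpoly R[2]}) : injective iota ->
  (forall n, exists ys : seq T, [/\ uniq ys, (n <= size ys)%N &
    forall y, y \in ys -> exists xs : seq T, [/\ uniq xs, (n <= size xs)%N &
      forall x, x \in xs -> mmap iota (fun i => if i == ord0 then x else y) p = 0]]) ->
  p = 0.
Proof.
move=> iI H.
pose m0 (m : 'X_{1..2}) := m ord0; pose m1 (m : 'X_{1..2}) := m ord_max.
have mnm2_eq (m m' : 'X_{1..2}) : m0 m = m0 m' -> m1 m = m1 m' -> m = m'.
  move=> e0 e1; apply/mnmP => i; case: (unliftP ord0 i) => [j ->|->]; last exact: e0.
  have -> : fintype.lift ord0 j = ord_max by apply: val_inj; rewrite /= (ord1 j).
  exact: e1.
pose P : {poly {poly T}} :=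
  \sum_(m <- msupp p) ((iota p@_m)%:P * 'X^(m1 m)) *: 'X^(m0 m).
have evP x y : P.[x%:P].[y] = mmap iota (fun i => if i == ord0 then x else y) p.
  rewrite /mmap !horner_sum; apply: eq_bigr => m _.
  rewrite /mmap1 !big_ord_recl big_ord0 /= mulr1 !hornerE.
  have -> : fintype.lift ord0 ord0 = ord_max :> 'I_2 by apply: val_inj.
  exact: mulrAC.
have coefP m : P`_(m0 m)`_(m1 m) = iota p@_m.
  have [mp|mp] := boolP (m \in msupp p); last first.
    rewrite (memN_msupp_eq0 mp) rmorph0 /P !coef_sum big_seq big1 // => m' m'p.
    rewrite coefZ coefXn; case: eqP => [e0|_]; last by rewrite mulr0 coef0.
    rewrite mulr1 coefCM coefXn; case: eqP => [e1|_]; last by rewrite mulr0.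
    case/negP: mp; suff -> : m = m' by [].
    exact: mnm2_eq.
  rewrite /P !coef_sum (bigD1_seq m) //= !coefZ !coefXn eqxx mulr1 coefCM coefXn.
  rewrite eqxx mulr1 big1_seq ?addr0 // => m' /andP[mm' _].
  rewrite coefZ coefXn; case: eqP => [e0|_]; last by rewrite mulr0 coef0.
  rewrite mulr1 coefCM coefXn; case: eqP => [e1|_]; last by rewrite mulr0.
  case/eqP: mm'; exact: mnm2_eq.
suff P0 : P = 0.
  by apply/mpolyP => m; apply: iI; rewrite -coefP P0 !coef0 mcoeff0 rmorph0.
apply/polyP => i; rewrite coef0.
(* This bound dominates the size in the first variable and that of the coefficient under
   scrutiny. *)
have [ys [yu yn yH]] := H (maxn (size P) (size P`_i)).
apply/eqP; apply/negPn/negP => Pi0.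
suff : (size ys < size (P`_i)%R)%N.
  by rewrite ltnNge (leq_trans _ yn) // leq_maxr.
apply: max_poly_roots => //; apply/allP => y /yH [xs [xu xn xH]].
have -> : root P`_i y = ((map_poly (horner_eval y) P)`_i == 0).
  by rewrite coef_map.
suff -> : map_poly (horner_eval y) P = 0 by rewrite coef0.
apply/eqP; apply/negPn/negP => Py0.
suff : (size xs < size (map_poly (horner_eval y) P))%N.
  rewrite ltnNge (leq_trans _ xn) // (leq_trans (size_poly _ _)) //.
  exact: leq_maxl.
apply: max_poly_roots => //; apply/allP => x /xH e.
have := horner_map (horner_eval y) P x%:P; rewrite /= /horner_eval hornerC.
by move=> e'; rewrite /root -/(horner_eval y) e' evP e.
Qed.

End Density.

(** * G-sets cut out by invariant conditions *)

Section SubGsets.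
Variables (G : groupType) (Om : gset G).
Implicit Types X Y : gset G.

Lemma sig_val_inj (T : Type) (P : T -> Prop) : injective (@proj1_sig T P).
Proof. by move=> [x Px] [y Py] /= xy; apply: eq_exist. Qed.

Definition sub_gset X (P : X -> Prop) (PG : forall g x, P x -> P (act g x)) :
  gset G.
Proof.
refine (@GSet G {x | P x} (fun g u => exist _ _ (PG g _ (proj2_sig u))) _ _).
- by move=> u; apply: sig_val_inj; apply: act1.
- by move=> g h u; apply: sig_val_inj; apply: actM.
Defined.

Lemma sub_gset_stabilizer X (P : X -> Prop) PG (u : @sub_gset X P PG) :
  stabilizer u = stabilizer (proj1_sig u).
Proof.
rewrite predeqE => g; split; first by move=> /(congr1 (@proj1_sig _ _)).
by move=> gu; apply: sig_val_inj.
Qed.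

Lemma sub_gset_smooth X (P : X -> Prop) PG :
  smooth Om X -> smooth Om (@sub_gset X P PG).
Proof. by move=> Xs u; rewrite sub_gset_stabilizer. Qed.

Lemma sub_gset_orbit X (P : X -> Prop) PG (u v : @sub_gset X P PG) :
  orbit u v <-> orbit (proj1_sig u) (proj1_sig v).
Proof.
split=> -[g _ e]; exists g => //; first by rewrite -e.
exact: sig_val_inj.
Qed.

Lemma sub_gset_fin_orbits X (P : X -> Prop) PG :
  fin_orbits X -> fin_orbits (@sub_gset X P PG).
Proof.
move=> [n [r [rc _]]].
apply: (@cover_fin _ (@sub_gset X P PG) _ (fun u i => orbit (r i) (proj1_sig u))).
  by move=> u; apply: rc.
move=> u v i iu iv; apply/sub_gset_orbit.
by rewrite -(orbit_eq iu).
Qed.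

(** An invariant is constant on orbits, so its values partition any transversal. *)
Lemma gset_class_fibers X (I : finType) (f : X -> I)
    (fG : forall i g x, f x = i -> f (act g x) = i) : fin_orbits X ->
  gset_class Om X = \sum_i gset_class Om (sub_gset (fG i)).
Proof.
move=> [n [r rT]]; have [rc ri] := rT.
rewrite (gset_class_transversal Om rT) (partition_big (f \o r) xpredT) //=.
apply: eq_bigr => i _.
pose ri' (j : {j | f (r j) == i}) : sub_gset (fG i) := exist _ _ (eqP (valP j)).
have riT : transversal ri'.
  split=> [[x xi]|j k /sub_gset_orbit /ri /val_inj //].
  have [j jx] := rc x; have ji : f (r j) == i.
    by have [g _ gx] := jx; rewrite -(fG _ g _ (erefl (f (r j)))) gx xi.
  by exists (Sub j ji); apply/sub_gset_orbit.
rewrite (gset_class_transversal Om riT).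
rewrite (reindex_omap (val : {j | f (r j) == i} -> _) insub) /=; last first.
  by move=> j ji; rewrite insubT.
apply: eq_big => [j|j _]; first by rewrite (valP j) valK eqxx.
apply/transitive_class_eq/orbit_iso.
by rewrite sub_gset_stabilizer.
Qed.

End SubGsets.

(** * Marks *)

Section Marks.
Variables (G : groupType) (Om : gset G) (U : set G).
Implicit Types X Y : gset G.

Definition fixed_by X (x : X) : Prop := forall g, U g -> act g x = x.

(** A relation rather than a function: a [G]-set may have infinitely many fixed points. *)
Definition fix_count X (n : nat) : Prop :=
  exists f : 'I_n -> X, injective f /\ forall x, fixed_by x <-> exists i, f i = x.

Lemma fix_countI X (T : finType) (f : T -> X) : injective f ->
  (forall x, fixed_by x <-> exists t, f t = x) -> fix_count X #|T|.
Proof.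
move=> fI fP; exists (f \o enum_val); split; first exact: inj_comp fI enum_val_inj.
move=> x; split=> [/fP [t <-]|[i <-]]; last by apply/fP; exists (enum_val i).
by exists (enum_rank t); rewrite /= enum_rankK.
Qed.

Lemma fix_count_finite X (T : finType) (enc : X -> T) :
  (forall x y, fixed_by x -> fixed_by y -> enc x = enc y -> x = y) ->
  exists n, fix_count X n.
Proof.
move=> encI; pose good t := `[< exists2 x, fixed_by x & enc x = t >].
have gP (t : {t | good t}) : {x | fixed_by x & enc x = val t}.
  by case: t => t /= /asboolP /cid2.
pose f t := s2val (gP t).
have fF t : fixed_by (f t) by rewrite /f; case: (gP t).
have fE t : enc (f t) = val t by rewrite /f; case: (gP t).
exists #|{: {t | good t}}|; apply: (@fix_countI _ _ f).
  by move=> s t e; apply: val_inj; rewrite -!fE e.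
move=> x; split=> [xF|[t <-]]; last exact: fF.
have xg : good (enc x) by apply/asboolP; exists x.
by exists (Sub (enc x) xg); apply: encI => //; rewrite fE.
Qed.

Lemma fix_count_le X m n : fix_count X m -> fix_count X n -> (m <= n)%N.
Proof.
move=> [f [fI fP]] [h [hI hP]].
have fh i : exists j, h j = f i by apply/hP/fP; exists i.
pose k i := projT1 (cid (fh i)).
have kE i : h (k i) = f i by rewrite /k; case: cid.
have kI : injective k by move=> i j ij; apply: fI; rewrite -!kE ij.
by have := leq_card k kI; rewrite !card_ord.
Qed.

Lemma fix_count_uniq X m n : fix_count X m -> fix_count X n -> m = n.
Proof. by move=> Xm Xn; apply/anti_leq; rewrite !(@fix_count_le X). Qed.

Lemma fix_count_iso X Y n : gset_iso X Y -> fix_count X n -> fix_count Y n.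
Proof.
move=> [h [[h' hK h'K] hG]] [f [fI fP]]; exists (h \o f); split.
  exact: inj_comp (can_inj hK) fI.
have fixh x : fixed_by (h x) <-> fixed_by x.
  split=> xF g /xF; rewrite -hG; first exact: (can_inj hK).
  by move=> ->.
move=> y; rewrite -[y]h'K; split=> [/fixh /fP [i <-]|[i /= <-]]; first by exists i.
by apply/fixh/fP; exists i.
Qed.

Lemma fix_count_prod X Y m n : fix_count X m -> fix_count Y n ->
  fix_count (prod_gset X Y) (m * n).
Proof.
move=> [f [fI fP]] [h [hI hP]].
rewrite -[m]card_ord -[n]card_ord -card_prod.
apply: (@fix_countI (prod_gset X Y) _ (fun u => (f u.1, h u.2))).
  by move=> [i j] [i' j'] [/fI -> /hI ->].
move=> [x y]; split=> [xyF|[[i j] /= [<- <-]] g Ug].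
  have /fP [i <-] : fixed_by x by move=> g /xyF [].
  have /hP [j <-] : fixed_by y by move=> g /xyF [].
  by exists (i, j).
have fF : fixed_by (f i) by apply/fP; exists i.
have hF : fixed_by (h j) by apply/hP; exists j.
by rewrite /= fF ?hF.
Qed.

Lemma fix_count_transversal X (I : finType) (r : I -> X) (c : I -> nat) :
  transversal r ->
  (forall i, fix_count (orbit_gset (orbit_of (r i))) (c i)) ->
  fix_count X (\sum_i c i).
Proof.
move=> [rc ri] /(fun H i => cid (H i)) H.
pose f i := projT1 (H i); have fI i : injective (f i) := (projT2 (H i)).1.
have fP i := (projT2 (H i)).2; rewrite -/(f _) in fP.
have fixE i (u : orbit_gset (orbit_of (r i))) : fixed_by u <-> fixed_by (val u).
  by split=> uF g Ug; [have /(congr1 val) := uF g Ug | apply/val_inj/uF].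
have <- : #|{: {i & 'I_(c i)}}| = (\sum_i c i)%N.
  by rewrite card_tagged sumnE big_map big_enum; apply: eq_bigr => i _; rewrite card_ord.
apply: (@fix_countI _ _ (fun u : {i & 'I_(c i)} => val (f (tag u) (tagged u)))).
  move=> [i t] [j s] /= e.
  have ij : i = j.
    apply: ri.
    (* Two orbits that share a point coincide, hence the group element [1]. *)
    apply: (orbit_meet (g := 1%g) (set_mem (valP (f i t))) (set_mem (valP (f j s)))).
    exact: etrans (act1 _ _) e.
  by case: _ / ij s e => s /val_inj /fI ->.
move=> x; split=> [xF|[[i t] /= <-]]; last by apply/fixE/fP; exists t.
have [i ix] := rc x.
have [|t tx] := (fP i (SigSub (mem_set ix))).1; first exact/fixE.
by exists (existT (fun i => 'I_(c i)) i t); rewrite /= /f tx.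
Qed.

Hypothesis Om_oligo : forall n, exists (I : finType) (d : I -> seq Om),
  forall s : seq Om, size s = n -> exists i g, map (act g) s = d i.
Hypothesis fix_finite : forall X, gset_transitive X -> smooth Om X ->
  exists n, fix_count X n.

Definition mark_count (k : transitive_classes Om) : nat :=
  xget 0%N [set n | fix_count (class_rep k) n]%classic.

Lemma mark_countP k : fix_count (class_rep k) (mark_count k).
Proof.
have [ kt ks _] := class_repP k; have [n kn] := fix_finite kt ks.
exact: (xgetPex 0%N (ex_intro _ n kn)).
Qed.

(** Burnside's mark homomorphism at [U]; [int^o] is [int] as a module over itself, the kind of
    target that [fglift] expects. *)
Definition mark (x : burnside Om) : int :=
  fglift (fun k => (mark_count k)%:Z : int^o) x.

Lemma mark_zmod_morphism : zmod_morphism mark.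
Proof. exact: (lift_is_additive (fun k => (mark_count k)%:Z : int^o)). Qed.

HB.instance Definition _ :=
  GRing.isZmodMorphism.Build (burnside Om) int mark mark_zmod_morphism.

Lemma mark_gset_class X n : smooth Om X -> fin_orbits X -> fix_count X n ->
  mark (gset_class Om X) = n%:Z.
Proof.
move=> Xs [m [r rT]] Xn.
have Os i := orbit_gset_smooth (O := orbit_of (r i)) Xs.
have Of i := fix_finite (orbit_gset_transitive (r i)) (Os i).
pose c i := projT1 (cid (Of i)).
have cP i : fix_count (orbit_gset (orbit_of (r i))) (c i) by rewrite /c; case: cid.
rewrite (fix_count_uniq Xn (fix_count_transversal rT cP)).
rewrite (gset_class_transversal Om rT) raddf_sum -natz natr_sum.
apply: eq_bigr => i _.
have [k -> ik] := transitive_classE (orbit_gset_transitive (r i)) (Os i).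
rewrite /= /mark liftU scale1r natz; congr Posz.
exact: fix_count_uniq (mark_countP k) (fix_count_iso ik (cP i)).
Qed.

Lemma mark1 : mark (burnside_one Om) = 1.
Proof.
have ut := unit_gset_transitive G.
rewrite /burnside_one (@mark_gset_class _ 1) //.
- exact: unit_gset_smooth.
- exact: transitive_fin_orbits.
rewrite -card_unit; apply: (@fix_countI (unit_gset G) _ id) => // x.
by split=> // _; exists x.
Qed.

(** By bilinearity only basis classes matter, and the fixed points of a product are the pairs of
    fixed points. *)
Lemma markM x y : mark (burnside_mul x y) = mark x * mark y.
Proof.
have mkE k : mark << k >> = (mark_count k)%:Z by rewrite /mark liftU scale1r.
elim/burnside_ind: x => [|x x' IH IH'|i].
- by rewrite burnside_mul0x raddf0 mul0r.
- by rewrite burnside_mulBl !raddfB /= IH IH' mulrBl.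
elim/burnside_ind: y => [|y y' IH IH'|j].
- by rewrite (burnside_mulx0 Om_oligo) raddf0 mulr0.
- by rewrite (burnside_mulBr Om_oligo) !raddfB /= IH IH' mulrBr.
have s := class_rep_smooth; have f := class_rep_fin.
rewrite burnside_mulU (mark_gset_class _ _ (fix_count_prod (mark_countP i) (mark_countP j))).
- by rewrite !mkE PoszM.
- exact: smooth_prod.
- exact: fin_orbits_prod.
Qed.

End Marks.

(** * Alternating matrices *)

Section AlternatingMatrices.
Variable F : fieldType.

Lemma trmxN m n (A : 'M[F]_(m, n)) : (- A)^T = - A^T.
Proof. exact: linearN. Qed.

(** In characteristic 2 the condition [M^T = - M] would be too weak. *)
Definition alternating k (M : 'M[F]_k) : Prop :=
  forall v : 'rV_k, v *m M *m v^T = 0.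

Lemma alternating_congr k l (P : 'M_(l, k)) (M : 'M_k) :
  alternating M -> alternating (P *m M *m P^T).
Proof.
by move=> Ma v; rewrite -(Ma (v *m P)) trmx_mul !mulmxA.
Qed.

Lemma alternating_tr k (M : 'M_k) : alternating M -> M^T = - M.
Proof.
move=> Ma; have D (u v : 'rV_k) : u *m M *m v^T = - (v *m M *m u^T).
  have := Ma (u + v); rewrite linearD mulmxDl !mulmxDl !mulmxDr !Ma add0r addr0.
  by move/eqP; rewrite addr_eq0 => /eqP.
apply/matrixP => i j; have := congr1 (fun A : 'M_1 => A 0 0) (D (delta_mx 0 j) (delta_mx 0 i)).
by rewrite /= !trmx_delta -!rowE -!colE !mxE.
Qed.

Lemma alternating_diag k (M : 'M_k) i : alternating M -> M i i = 0.
Proof.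
move=> /(_ (delta_mx 0 i)) /(congr1 (fun A : 'M_1 => A 0 0)).
by rewrite trmx_delta -rowE -colE !mxE.
Qed.

Lemma alternating0 k : alternating (0 : 'M_k).
Proof. by move=> v; rewrite mulmx0 mul0mx. Qed.

Lemma alternating_1 (M : 'M_1) : alternating M -> M = 0.
Proof.
by move=> Ma; apply/matrixP => i j; rewrite !ord1 alternating_diag // mxE.
Qed.

Lemma alternating_block m n (A : 'M_m) (B : 'M_(m, n)) (D : 'M_n) :
  alternating A -> alternating D -> alternating (block_mx A B (- B^T) D).
Proof.
move=> Aa Da v; rewrite -[v]hsubmxK tr_row_mx mul_row_block mul_row_col.
rewrite !mulmxDl Aa Da add0r addr0 mulmxN mulNmx.
(* The cross terms are transposes of each other up to sign, and a 1 x 1 matrix is its own transpose,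
   so they cancel. *)
have -> : rsubmx v *m B^T *m (lsubmx v)^T = (lsubmx v *m B *m (rsubmx v)^T)^T.
  by rewrite !trmx_mul trmxK mulmxA.
by apply/matrixP => i j; rewrite !ord1 !mxE addNr.
Qed.

Lemma alternating_block_inv m n (A : 'M_m) B C (D : 'M_n) :
  alternating (block_mx A B C D) ->
  [/\ alternating A, C = - B^T & alternating D].
Proof.
move=> Ma; split.
- have := alternating_congr (row_mx 1%:M 0) Ma.
  rewrite mul_row_block tr_row_mx mul_row_col !trmx0 mulmx0 !mul0mx !mul1mx !addr0.
  by rewrite trmx1 mulmx1.
- have := alternating_tr Ma; rewrite tr_block_mx opp_block_mx => /eq_block_mx [_ _ e _].
  by rewrite e opprK.
- have := alternating_congr (row_mx 0 1%:M) Ma.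
  rewrite mul_row_block tr_row_mx mul_row_col !trmx0 mulmx0 !mul0mx !mul1mx !add0r.
  by rewrite trmx1 mulmx1.
Qed.

(** In the rank normal form of a matrix of full row rank the middle factor is the block row of [1]
    and [0], so it suffices to enlarge the left factor by an identity block. *)
Lemma unitmx_complete m n (E : 'M[F]_(m, m + n)) : row_free E ->
  exists2 P : 'M_(m + n), P \in unitmx & usubmx P = E.
Proof.
move=> /eqP Er; exists (block_mx (col_ebase E) 0 0 1%:M *m row_ebase E).
  by rewrite unitmx_mul row_ebase_unit unitmxE det_ublock det1 mulr1 -unitmxE col_ebase_unit.
rewrite -[in RHS](mulmx_ebase E) Er -[row_ebase E in LHS]vsubmxK mul_block_col.
rewrite col_mxKu mul0mx addr0 -[row_ebase E in RHS]vsubmxK -mulmxA; congr (_ *m _).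
suff -> : pid_mx m = row_mx 1%:M 0 :> 'M[F]_(m, m + n).
  by rewrite mul_row_col mul1mx mul0mx addr0.
apply/matrixP => i j; rewrite [LHS]mxE [RHS]mxE; case: splitP => j' jE; rewrite !mxE jE.
  by rewrite ltn_ord andbT.
by rewrite ltn_eqF // (leq_trans (ltn_ord i)) ?leq_addr.
Qed.

(** Gram matrix of two vectors with pairing [c]: a hyperbolic plane for [c != 0], the zero form for
    [c = 0]. *)
Definition hyp_mx (c : F) : 'M[F]_(1 + 1) := block_mx 0 c%:M (- c%:M) 0.

Lemma alternating_hyp c : alternating (hyp_mx c).
Proof.
have := alternating_block c%:M (@alternating0 1) (@alternating0 1).
by rewrite tr_scalar_mx.
Qed.

Lemma hyp_mx_unit c : c != 0 -> hyp_mx c \in unitmx.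
Proof.
move=> c0; apply: (proj1 (mulmx1_unit (B := block_mx 0 (- c^-1%:M) c^-1%:M 0) _)).
rewrite mulmx_block !(mul0mx, mulmx0, mulNmx, mulmxN, opprK, add0r, addr0).
by rewrite -!scalar_mxM mulfV // -scalar_mx_block.
Qed.

Lemma alternating_2 (N : 'M_(1 + 1)) : alternating N -> N = hyp_mx (N 0 (rshift 1 0)).
Proof.
move=> Na; have := Na; rewrite -{1}[N]submxK.
move=> /alternating_block_inv [/alternating_1 a b /alternating_1 d].
have u : ursubmx N = (N 0 (rshift 1 0))%:M.
  rewrite [LHS]mx11_scalar !mxE; congr (N _ _)%:M; exact: val_inj.
by rewrite -[LHS]submxK a b d u tr_scalar_mx.
Qed.

(** Completing the square: subtracting [u] times the last [n] vectors from the first [m] clears an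
    off-diagonal block whose rows lie in the row space of [M]. *)
Lemma congr_clear_right m n (N : 'M[F]_m) (M : 'M_n) (u : 'M_(m, n)) :
  M^T = - M -> exists2 P : 'M_(m + n), P \in unitmx &
  P *m block_mx N (u *m M) (- (u *m M)^T) M *m P^T =
    block_mx (N - u *m M *m u^T) 0 0 M.
Proof.
move=> Mt; exists (block_mx 1%:M (- u) 0 1%:M).
  by rewrite unitmxE det_ublock !det1 mulr1 unitr1.
rewrite tr_block_mx !mulmx_block !trmx1 trmx0 !trmxN trmx_mul Mt.
rewrite !(mul1mx, mulmx1, mul0mx, mulmx0, mulNmx, mulmxN, opprK, add0r, addr0).
by rewrite !subrr mul0mx subr0 mulmxA.
Qed.

Lemma congr_clear_left m n (M : 'M[F]_m) (N : 'M_n) (B : 'M_(m, n)) :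
  M \in unitmx -> M^T = - M -> exists2 P : 'M_(m + n), P \in unitmx &
  exists N', P *m block_mx M B (- B^T) N *m P^T = block_mx M 0 0 N'.
Proof.
move=> Mu Mt; have [v ->] : exists v, B = M *m v.
  by exists (invmx M *m B); rewrite mulKVmx.
exists (block_mx 1%:M 0 (- v^T) 1%:M).
  by rewrite unitmxE det_lblock !det1 mulr1 unitr1.
exists (N - v^T *m M *m v).
rewrite tr_block_mx !mulmx_block !trmx1 trmx0 !trmxN trmxK trmx_mul Mt.
rewrite !(mul1mx, mulmx1, mul0mx, mulmx0, mulNmx, mulmxN, opprK, add0r, addr0).
by rewrite !addNr mul0mx oppr0 add0r mulmxA addrC.
Qed.

(** A nonzero kernel vector, taken as the first vector of a new basis, is orthogonal to
    everything. *)
Lemma alternating_singular k (M : 'M[F]_(1 + k)) : alternating M ->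
  M \notin unitmx -> exists2 P : 'M_(1 + k), P \in unitmx &
  exists2 M' : 'M_k, alternating M' & P *m M *m P^T = block_mx (0 : 'M_1) 0 0 M'.
Proof.
move=> Ma; rewrite -row_free_unit -kermx_eq0 => /rowV0Pn [v /sub_kermxP vM v0].
have [|P Pu Pv] := @unitmx_complete 1 k v; first by rewrite /row_free rank_rV v0.
exists P => //; have := alternating_congr P Ma.
have e : usubmx (P *m M *m P^T) = 0.
  by rewrite -mulmxA -mul_usub_mx Pv mulmxA vM mul0mx.
rewrite -[P *m M *m P^T]submxK /ulsubmx /ursubmx e !linear0.
move=> /alternating_block_inv [_ -> Na]; rewrite trmx0 oppr0.
by exists (drsubmx (P *m M *m P^T)).
Qed.

(** Complete a hyperbolic pair [e], [f] to a basis, then clear the off-diagonal blocks against the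
    invertible block [hyp_mx 1]. *)
Lemma alternating_unit k (M : 'M[F]_(2 + k)) : alternating M ->
  M \in unitmx -> exists2 P : 'M_(2 + k), P \in unitmx &
  exists2 M' : 'M_k, alternating M' /\ M' \in unitmx &
    P *m M *m P^T = block_mx (hyp_mx 1) 0 0 M'.
Proof.
move=> Ma Mu; pose e : 'rV[F]_(2 + k) := delta_mx 0 ord0.
have e0 : e *m M != 0.
  apply/eqP => /(congr1 (mulmx^~ (invmx M))); rewrite mulmxK // mul0mx.
  by move/matrixP => /(_ 0 ord0); rewrite !mxE !eqxx => /eqP; rewrite oner_eq0.
have [j ej] : exists j, (e *m M) 0 j != 0 by apply/rV0Pn.
(* Rescaling a basis vector that pairs non-trivially with [e] gives its hyperbolic partner. *)
pose f : 'rV[F]_(2 + k) := ((e *m M) 0 j)^-1 *: delta_mx 0 j.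
have ef : e *m M *m f^T = 1.
  rewrite /f linearZ /= trmx_delta -scalemxAr -colE; apply/matrixP => i i'.
  by rewrite !ord1 !mxE; move: ej; rewrite !mxE; exact: mulVf.
pose E : 'M[F]_(1 + 1, 2 + k) := col_mx e f.
have EE : E *m M *m E^T = hyp_mx 1.
  rewrite /E mul_col_mx tr_col_mx mul_col_row !Ma ef.
  have -> : f *m M *m e^T = - (e *m M *m f^T)^T.
    by rewrite !trmx_mul trmxK (alternating_tr Ma) mulNmx mulmxN opprK mulmxA.
  by rewrite ef trmx1.
have [|P Pu PE] := @unitmx_complete 2 k E.
  (* A right inverse of [E], because [E *m M *m E^T] is the invertible [hyp_mx 1]. *)
  apply/row_freeP; exists (M *m E^T *m invmx (hyp_mx 1)).
  by rewrite !mulmxA EE mulmxV // hyp_mx_unit ?oner_neq0.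
have := alternating_congr P Ma.
have e1 : ulsubmx (P *m M *m P^T) = hyp_mx 1.
  rewrite -EE -PE -[P in LHS]vsubmxK tr_col_mx mul_col_mx mul_col_row.
  by rewrite block_mxKul.
rewrite -[P *m M *m P^T]submxK e1 => Ea.
have [_ e3 _] := alternating_block_inv Ea; rewrite e3 in Ea *.
have [|Q Qu [N QE]] := congr_clear_left (drsubmx (P *m M *m P^T))
    (ursubmx (P *m M *m P^T)) (hyp_mx_unit (oner_neq0 F)).
  exact/alternating_tr/alternating_hyp.
have PQ : Q *m P *m M *m (Q *m P)^T = block_mx (hyp_mx 1) 0 0 N.
  by rewrite -QE -e3 -e1 submxK trmx_mul !mulmxA.
exists (Q *m P); first by rewrite unitmx_mul Qu.
exists N => //; split.
  by have := alternating_congr (Q *m P) Ma; rewrite PQ => /alternating_block_inv [].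
have : Q *m P *m M *m (Q *m P)^T \in unitmx.
  by rewrite unitmx_mul unitmx_tr !unitmx_mul Qu Pu Mu.
by rewrite PQ unitmxE det_ublock unitrM -!unitmxE => /andP[].
Qed.

End AlternatingMatrices.

(** * Counting over a finite field *)

Section Counting.
Variable F : finFieldType.
Local Notation q := #|F|.

Lemma card_rV k : #|{: 'rV[F]_k}| = (q ^ k)%N.
Proof. by rewrite card_mx mul1n. Qed.

Lemma card_row_space m k (A : 'M[F]_(m, k)) :
  #|[pred v : 'rV_k | (v <= A)%MS]| = (q ^ \rank A)%N.
Proof.
rewrite -card_rV -(card_imset predT (row_free_inj (row_base_free A))).
apply: eq_card => v; rewrite inE -(eq_row_base A).
apply/submxP/imsetP => [[D ->]|[D _ ->]]; last by exists D.
by exists D.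
Qed.

(** Translation by multiples of a vector [w0] with [u *m w0^T = 1] permutes the [q] fibres
    transitively, so they have equal size. *)
Lemma card_dual_fiber k (u : 'rV[F]_k) (c : 'M_1) : u != 0 ->
  (q * #|[pred w : 'rV_k | u *m w^T == c]| = q ^ k)%N.
Proof.
move=> u0; have [w0 uw0] : exists w0 : 'rV_k, u *m w0^T = 1.
  have [j uj] : exists j, u 0 j != 0 by apply/rV0Pn.
  exists ((u 0 j)^-1 *: delta_mx 0 j).
  rewrite linearZ /= trmx_delta -scalemxAr -colE; apply/matrixP => i i'.
  by rewrite !ord1 !mxE mulVf.
have fiberE (d : 'M_1) : #|[pred w : 'rV_k | u *m w^T == d]| =
    #|[pred w : 'rV_k | u *m w^T == c]|.
  rewrite -(card_imset _ (addIr ((c - d) 0 0 *: w0))).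
  apply: eq_card => w; rewrite inE.
  have uE w' : u *m (w' + (c - d) 0 0 *: w0)^T = u *m w'^T + (c - d).
    rewrite linearD linearZ mulmxDr -scalemxAr uw0 scalemx1; congr (_ + _).
    by rewrite -mx11_scalar.
  apply/imsetP/eqP => [[w' /eqP uw' ->]|uw].
    by rewrite uE uw' addrC subrK.
  exists (w - (c - d) 0 0 *: w0); last by rewrite subrK.
  rewrite inE -(inj_eq (addIr (c - d))) -uE subrK uw.
  by rewrite addrC subrK.
transitivity (\sum_(d : 'M[F]_1) #|[pred w : 'rV_k | u *m w^T == d]|)%N.
  by rewrite (eq_bigr _ (fun d _ => fiberE d)) sum_nat_const card_mx expn1.
rewrite -card_rV -sum1_card (partition_big (fun w : 'rV_k => u *m w^T) xpredT) //=.
by apply: eq_bigr => d _; rewrite -sum1_card.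
Qed.

(* Pairs [(u, w)] with [u *m M *m w^T = 1]: rows [u] in the kernel of [M]
   contribute nothing, all the others contribute [q ^ k / q]. *)
Lemma card_unit_pairs k (M : 'M[F]_k) :
  (q * #|[pred p : 'rV_k * 'rV_k | (p.1 *m M *m p.2^T == 1)%R]| +
   q ^ k * q ^ (k - \rank M) = q ^ k * q ^ k)%N.
Proof.
have -> : #|[pred p : 'rV_k * 'rV_k | (p.1 *m M *m p.2^T == 1)%R]| =
    (\sum_(u : 'rV_k) \sum_(w : 'rV_k | (u *m M *m w^T == 1)%R) 1)%N.
  by rewrite pair_big_dep -sum1_card.
rewrite -mxrank_ker -card_row_space big_distrr /=.
rewrite (bigID (fun u => (u <= kermx M)%MS)) /= big1 ?add0n; last first.
  move=> u /sub_kermxP uM; rewrite big1 ?muln0 // => w.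
  by rewrite uM mul0mx eq_sym oner_eq0.
rewrite (eq_bigr (fun=> q ^ k)%N); last first.
  move=> u /sub_kermxP /eqP uM; rewrite sum1_card; exact: card_dual_fiber.
rewrite sum_nat_const mulnC -mulnDr -{3}card_rV addnC; congr (_ * _)%N.
exact: cardC.
Qed.

End Counting.

(** * Families of vectors and Witt's theorem *)

Lemma linear_at0 (F : fieldType) (U W : lmodType F) (g : U -> W) :
  linear g -> g 0 = 0.
Proof. by move=> /(_ (-1) 0 0); rewrite scaler0 addr0 scaleN1r addNr. Qed.

Section Families.
Variables (F : fieldType) (V : formed_space F).

Definition lin k (s : 'I_k -> V) (c : 'rV[F]_k) : V := \sum_i c 0 i *: s i.

Definition gram k (s : 'I_k -> V) : 'M[F]_k := \matrix_(i, j) sform (s i) (s j).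

Definition independent k (s : 'I_k -> V) : Prop := forall c, lin s c = 0 -> c = 0.

Definition recombine k l (P : 'M[F]_(l, k)) (s : 'I_k -> V) : 'I_l -> V :=
  fun i => lin s (row i P).

Definition fcat m n (s : 'I_m -> V) (t : 'I_n -> V) (i : 'I_(m + n)) : V :=
  match fintype.split i with inl j => s j | inr j => t j end.

Lemma lin_linear k (s : 'I_k -> V) : linear (lin s).
Proof.
move=> a c d; rewrite /lin scaler_sumr -big_split; apply: eq_bigr => i _.
by rewrite !mxE scalerDl scalerA.
Qed.

HB.instance Definition _ k (s : 'I_k -> V) :=
  GRing.isLinear.Build F 'rV[F]_k V *:%R (lin s) (lin_linear s).

Lemma lin_delta k (s : 'I_k -> V) i : lin s (delta_mx 0 i) = s i.
Proof.
rewrite /lin (bigD1 i) //= !mxE !eqxx scale1r big1 ?addr0 // => j ji.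
by rewrite !mxE (negbTE ji) andbF scale0r.
Qed.

Lemma independent_inj k (s : 'I_k -> V) : independent s -> injective (lin s).
Proof.
by move=> si c d cd; apply/eqP; rewrite -subr_eq0; apply/eqP/si; rewrite linearB /= cd subrr.
Qed.

Lemma sform_lin k l (s : 'I_k -> V) (t : 'I_l -> V) c d :
  sform (lin s c) (lin t d) =
  (c *m (\matrix_(i, j) sform (s i) (t j)) *m d^T) 0 0.
Proof.
rewrite /lin linear_sumlz !mxE.
under eq_bigr do rewrite linearZl_LR linear_sumr /=.
under [RHS]eq_bigr do rewrite !mxE mulr_suml.
rewrite exchange_big /=; apply: eq_bigr => i _; rewrite mulr_sumr.
by apply: eq_bigr => j _; rewrite linearZr_LR !mxE /=; ring.
Qed.

Lemma gram_alternating k (s : 'I_k -> V) : alternating (gram s).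
Proof.
move=> v; apply/matrixP => i j; rewrite !ord1 -sform_lin sform_alt.
by rewrite mxE.
Qed.

Lemma lin_recombine k l (P : 'M[F]_(l, k)) (s : 'I_k -> V) c :
  lin (recombine P s) c = lin s (c *m P).
Proof.
rewrite {1}/lin /recombine mulmx_sum_row linear_sum.
by apply: eq_bigr => i _; rewrite linearZ.
Qed.

Lemma recombineK k (P Q : 'M[F]_k) : P *m Q = 1%:M -> cancel (recombine Q) (recombine P).
Proof.
move=> PQ s; apply: funext => i; rewrite /recombine lin_recombine.
by rewrite -row_mul PQ row1 lin_delta.
Qed.

Lemma gram_recombine k l (P : 'M[F]_(l, k)) (s : 'I_k -> V) :
  gram (recombine P s) = P *m gram s *m P^T.
Proof.
apply/matrixP => i j; rewrite mxE sform_lin -/(gram s) tr_row -row_mul.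
rewrite [LHS]mxE [RHS]mxE; apply: eq_bigr => l' _.
by rewrite !mxE.
Qed.

Lemma fcatl m n (s : 'I_m -> V) (t : 'I_n -> V) i : fcat s t (lshift n i) = s i.
Proof. by rewrite /fcat (unsplitK (inl i)). Qed.

Lemma fcatr m n (s : 'I_m -> V) (t : 'I_n -> V) i : fcat s t (rshift m i) = t i.
Proof. by rewrite /fcat (unsplitK (inr i)). Qed.

Lemma lin_fcat m n (s : 'I_m -> V) (t : 'I_n -> V) c :
  lin (fcat s t) c = lin s (lsubmx c) + lin t (rsubmx c).
Proof.
rewrite /lin big_split_ord; congr (_ + _); apply: eq_bigr => i _.
  by rewrite fcatl mxE.
by rewrite fcatr mxE.
Qed.

Lemma gram_fcat m n (s : 'I_m -> V) (t : 'I_n -> V) :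
  let B := \matrix_(i, j) sform (s i) (t j) in
  gram (fcat s t) = block_mx (gram s) B (- B^T) (gram t).
Proof.
apply/matrixP => i j; rewrite mxE.
case: (split_ordP i) => i' ->; case: (split_ordP j) => j' ->;
  rewrite ?(block_mxEul, block_mxEur, block_mxEdl, block_mxEdr) ?fcatl ?fcatr !mxE //.
exact: sform_skew.
Qed.

Lemma independent_fcat k (s : 'I_k -> V) (x : V) : independent s ->
  ~ (exists c, x = lin s c) -> independent (fcat s (fun _ : 'I_1 => x)).
Proof.
move=> si xs c; rewrite lin_fcat /lin big_ord1 -/(lin _ _).
set a := rsubmx c 0 0; have [a0|a0] := eqVneq a 0.
  rewrite a0 scale0r addr0 => /si e; rewrite -[c]hsubmxK e.
  by rewrite [rsubmx c]mx11_scalar -/a a0 raddf0 row_mx0.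
move=> e; case: xs; exists (- a^-1 *: lsubmx c); rewrite linearZ /=.
move/eqP: e; rewrite addr_eq0 => /eqP ->.
by rewrite scalerN scaleNr opprK scalerA mulVf // scale1r.
Qed.

Lemma aut_lin k (s : 'I_k -> V) (g : aut V) c :
  val g (lin s c) = lin (fun i => val g (s i)) c.
Proof.
pose gL := GRing.isLinear.Build F V V *:%R (val g) (aut_linear g).
pose g' : {linear V -> V} := HB.pack (val g) gL.
rewrite -[val g _]/(g' _) /lin linear_sum; apply: eq_bigr => i _.
by rewrite linearZ.
Qed.

Lemma independent_aut k (s : 'I_k -> V) (g : aut V) :
  independent s -> independent (fun i => val g (s i)).
Proof.
move=> si c; rewrite -aut_lin => e; apply: si; apply: (bij_inj (aut_bij g)).
by rewrite [RHS](linear_at0 (aut_linear g)).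
Qed.

Lemma gram_aut k (s : 'I_k -> V) (g : aut V) : gram (fun i => val g (s i)) = gram s.
Proof. by apply/matrixP => i j; rewrite !mxE aut_isometric. Qed.

(** The basis is extracted from [l] itself; this is what later allows its length to be compared with
    that of a dependent family. *)
Lemma exists_basis (l : seq V) : exists k (s : 'I_k -> V), [/\ independent s,
  forall x, x \in l -> exists c, x = lin s c & forall i, s i \in l].
Proof.
elim: l => [|x l [k [s [si sl ls]]]].
  exists 0%N, (fun _ => 0); split=> // [c _|[]//].
  by rewrite [c]thinmx0.
have [xs|xs] := pselect (exists c, x = lin s c).
  exists k, s; split=> // [y|i]; last by rewrite inE ls orbT.
  by rewrite inE => /orP[/eqP ->|/sl].
exists (k + 1)%N, (fcat s (fun=> x)); split.
- exact: independent_fcat.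
- move=> y; rewrite inE => /orP[/eqP ->|/sl [c ->]].
    by exists (delta_mx 0 (rshift k 0)); rewrite lin_delta fcatr.
  exists (row_mx c 0); rewrite lin_fcat row_mxKl row_mxKr linear0 addr0 //.
- by move=> i; case: (split_ordP i) => j ->; rewrite ?fcatl ?fcatr inE ?eqxx ?ls ?orbT.
Qed.

(** The transvection along [x - y] fixes everything orthogonal to [x - y]. *)
Lemma aut_move_fix (x y : V) : sform x y != 0 -> exists2 g : aut V,
  val g x = y & forall u, sform u x = sform u y -> val g u = u.
Proof.
move=> xy; exists (transvection_aut (x - y) (sform x y)^-1) => [|u uxy] /=.
  rewrite /transvection linearBr sform_alt sub0r mulrN mulVf // scaleN1r.
  by rewrite opprB addrC subrK.
by rewrite /transvection linearBr uxy subrr mulr0 scale0r addr0.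
Qed.

End Families.

(** * Duality and Witt's theorem in the infinite symplectic space *)

Section Witt.
Variable F : fieldType.
Local Notation V := (inf_space F).

Lemma lin_coef1 k (s : 'I_k -> V) (c : 'rV[F]_k) j :
  (lin s c).1`_j = \sum_i c 0 i * (s i).1`_j.
Proof.
rewrite /lin (big_morph (fun x : V => x.1`_j) (id1 := 0) (op1 := +%R)).
- by apply: eq_bigr => i _; rewrite coefZ.
- by move=> x y; rewrite coefD.
- by rewrite coef0.
Qed.

Lemma lin_coef2 k (s : 'I_k -> V) (c : 'rV[F]_k) j :
  (lin s c).2`_j = \sum_i c 0 i * (s i).2`_j.
Proof.
rewrite /lin (big_morph (fun x : V => x.2`_j) (id1 := 0) (op1 := +%R)).
- by apply: eq_bigr => i _; rewrite coefZ.
- by move=> x y; rewrite coefD.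
- by rewrite coef0.
Qed.

(** Independence says that the matrix of coordinates, cut off at a common degree bound [N], has full
    row rank, hence a right inverse, which solves the linear system for [w]. *)
Lemma dual_exists k (s : 'I_k -> V) (a : 'cV[F]_k) : independent s ->
  exists w : V, forall i, sform (s i) w = a i 0.
Proof.
move=> si.
have [N sN] : exists N, forall i, (size (s i).1 <= N)%N /\ (size (s i).2 <= N)%N.
  exists (\max_i maxn (size (s i).1) (size (s i).2)) => i.
  by apply/andP; rewrite -geq_max; apply: (leq_bigmax i).
pose A1 := \matrix_(i < k, j < N) (s i).1`_j.
pose A2 := \matrix_(i < k, j < N) (s i).2`_j.
have [B AB] : exists B, row_mx A1 A2 *m B = 1%:M.
  apply/row_freeP; rewrite -kermx_eq0; apply/rowV0P => c /sub_kermxP.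
  rewrite mul_mx_row -row_mx0 => /eq_row_mx [c1 c2]; apply: si.
  have big0 j (x : 'I_k -> {poly F}) : (forall i, size (x i) <= N)%N ->
      (N <= j)%N -> \sum_i c 0 i * (x i)`_j = 0.
    move=> xN jN; rewrite big1 // => i _.
    by rewrite [(x i)`_j]nth_default ?mulr0 // (leq_trans (xN i)).
  rewrite [LHS]surjective_pairing; congr pair; apply/polyP => j; rewrite coef0.
    rewrite lin_coef1; have [jN|] := ltnP j N; last by apply: big0 => i; case: (sN i).
    move/matrixP: c1 => /(_ 0 (Ordinal jN)); rewrite !mxE => e.
    by rewrite -[RHS]e; apply: eq_bigr => i _; rewrite mxE.
  rewrite lin_coef2; have [jN|] := ltnP j N; last by apply: big0 => i; case: (sN i).
  move/matrixP: c2 => /(_ 0 (Ordinal jN)); rewrite !mxE => e.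
  by rewrite -[RHS]e; apply: eq_bigr => i _; rewrite mxE.
pose b := B *m a.
have bE : row_mx A1 A2 *m b = a by rewrite mulmxA AB mul1mx.
(* The form pairs first components with second ones, with a minus sign for the other order; hence
   the swap and the sign. *)
exists (- rVpoly (dsubmx b)^T, rVpoly (usubmx b)^T) => i.
rewrite /sform /= /inf_form /= !(@coef_dotE _ N) ?(sN i).1 ?(sN i).2 //.
rewrite -[in RHS]bE -[b]vsubmxK mul_row_col !mxE col_mxKu col_mxKd; congr (_ + _).
  by apply: eq_bigr => j _; rewrite coef_rVpoly_ord !mxE.
rewrite -sumrN; apply: eq_bigr => j _.
by rewrite coefN coef_rVpoly_ord !mxE mulrN opprK.
Qed.

Lemma separation k (s : 'I_k -> V) (x : V) : independent s ->
  ~ (exists c, x = lin s c) ->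
  exists2 w : V, forall i, sform (s i) w = 0 & sform x w = 1.
Proof.
move=> si xs; pose a : 'cV[F]_(k + 1) := delta_mx (rshift k 0) 0.
have [w wE] := dual_exists a (independent_fcat si xs); exists w.
  move=> i; have := wE (lshift 1 i); rewrite fcatl mxE => ->.
  by rewrite eq_lrshift.
by have := wE (rshift k 0); rewrite fcatr mxE !eqxx.
Qed.

(** A vector [x] outside the span is moved by the transvection along some [w] that is orthogonal to
    the family but not to [x]. *)
Lemma fixed_lin k (s : 'I_k -> V) (x : V) : independent s ->
  (forall g : aut V, (forall i, val g (s i) = s i) -> val g x = x) ->
  exists c, x = lin s c.
Proof.
move=> si xfix; have [//|xs] := pselect (exists c, x = lin s c).
have [w ws xw] := separation si xs.
have := xfix (transvection_aut w 1) _; rewrite /= /transvection => e.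
have /eqP : x + (1 * sform x w) *: w = x.
  by apply: e => i; rewrite ws mulr0 scale0r addr0.
rewrite xw mulr1 scale1r -[X in _ == X]addr0 (inj_eq (addrI x)) => /eqP w0.
by move/eqP: xw; rewrite w0 linear0r eq_sym oner_eq0.
Qed.

(* Vectors are moved one at a time.  To send [x] to [y] while fixing the vectors
   that pair equally with both, use the transvection along [x - y]; when
   [sform x y = 0], go through [x + w] with [w] pairing non-trivially with both
   and orthogonal to the vectors already in place. *)
Lemma witt k (s t : 'I_k -> V) : independent s -> independent t ->
  gram s = gram t -> exists g : aut V, forall i, val g (s i) = t i.
Proof.
move=> si ti st.
suff H j : (j <= k)%N -> exists g : aut V, forall i : 'I_k, (i < j)%N -> val g (s i) = t i.
  by have [g gP] := H k (leqnn k); exists g => i; apply: gP.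
elim: j => [|j IH] jk; first by exists 1%g.
have [g gst] := IH (ltnW jk); pose j0 := Ordinal jk.
set s' := fun i => val g (s i).
have si' : independent s' by apply: independent_aut.
have st' i : sform (s' i) (s' j0) = sform (t i) (t j0).
  by move/matrixP: st => /(_ i j0); rewrite !mxE -(aut_isometric g).
have pre (i : 'I_k) : (i < j)%N -> sform (t i) (s' j0) = sform (t i) (t j0).
  by move=> ij; rewrite -st' /s' (gst i).
suff [h hx hfix] : exists2 h : aut V, val h (s' j0) = t j0 &
    forall i : 'I_k, (i < j)%N -> val h (t i) = t i.
  exists (h * g)%g => i; rewrite ltnS leq_eqVlt => /orP[/eqP ij|ij] /=.
    by rewrite (_ : i = j0) //; apply: val_inj.
  by rewrite gst // hfix.
have dual (u : 'I_k -> V) : independent u -> (forall i : 'I_k, (i < j)%N -> u i = t i) ->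
    exists2 w : V, sform (u j0) w = 1 & forall i : 'I_k, (i < j)%N -> sform (t i) w = 0.
  move=> ui ut; have [w wE] := dual_exists (delta_mx j0 0) ui.
  exists w; first by rewrite wE mxE !eqxx.
  move=> i ij; rewrite -ut // wE mxE (_ : (i == j0) = false) //.
  by rewrite -val_eqE ltn_eqF.
have [v xv tv] := dual s' si' gst; have [w yw tw] := dual t ti (fun _ _ => erefl).
have direct := @aut_move_fix F V; move: xv yw.
move: (s' j0) (t j0) pre => x y pre xv yw.
have [xy|xy] := eqVneq (sform x y) 0; last first.
  by have [h hx hfix] := direct x y xy; exists h => // i ij; apply: hfix; exact: pre.
(* One of [v], [w], [v + w] pairs non-trivially with both [x] and [y]. *)
have [z [xz yz tz]] : exists z, [/\ sform x z != 0, sform y z != 0 &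
    forall i : 'I_k, (i < j)%N -> sform (t i) z = 0].
  have [yv|yv] := eqVneq (sform y v) 0; last by exists v; rewrite xv oner_neq0.
  have [xw|xw] := eqVneq (sform x w) 0; last by exists w; rewrite yw oner_neq0.
  exists (v + w); rewrite !linearDr xv yw xw yv addr0 add0r oner_neq0.
  by split=> // i ij; rewrite linearDr tv ?tw ?addr0.
have [|h1 h1x h1fix] := direct x (x + z); first by rewrite linearDr sform_alt add0r.
have [|h2 h2x h2fix] := direct (x + z) y.
  by rewrite linearDl xy add0r sform_skew oppr_eq0.
exists (h2 * h1)%g => [|i ij] /=; first by rewrite h1x.
by rewrite h1fix ?h2fix // linearDr tz // addr0 ?pre.
Qed.
End Witt.

(** * Families with a given Gram matrix *)

Lemma gset_isoI (G : groupType) (X Y : gset G) (f : X -> Y) :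
  injective f -> (forall y, exists x, f x = y) ->
  (forall g x, f (act g x) = act g (f x)) -> gset_iso X Y.
Proof.
move=> fI fS fG; exists f; split=> //.
pose h y := projT1 (cid (fS y)); have fh y : f (h y) = y by rewrite /h; case: cid.
by exists h => // x; apply: fI; rewrite fh.
Qed.

Section GramSets.
Variable F : finFieldType.
Local Notation V := (inf_space F).
Local Notation B := (sp_burnside F).
Local Notation q := #|F|.

Definition family_gset (k : nat) : gset (aut V).
Proof.
refine (@GSet (aut V) ('I_k -> V) (fun g s i => val g (s i)) _ _) => //.
Defined.

Lemma family_smooth k : smooth (sp_gset F) (family_gset k).
Proof.
move=> s; exists (range s); first exact: finite_image.
rewrite predeqE => g; split=> [gs _ [i _ <-]|gs].
  exact: (congr1 (@^~ i) gs).
by apply: funext => i; apply: gs; exists i.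
Qed.

Lemma family_fin_orbits k : fin_orbits (family_gset k).
Proof.
have [I [d dP]] := @inf_oligo F k.
apply: (@cover_fin _ (family_gset k) I
  (fun s i => exists g : aut V, map (fun j => val g (s j)) (enum 'I_k) = d i)).
  move=> s; have [|i [g e]] := dP (map s (enum 'I_k)).
    by rewrite size_map size_enum_ord.
  by exists i, g; rewrite -e /= -map_comp.
move=> s t i [g <-] [h /eq_in_map e]; exists (h^-1 * g)%g => //.
apply: funext => j; rewrite -[RHS](aut_inv_funK h).
exact: (congr1 (aut_inv_fun h) (esym (e j (mem_enum _ j)))).
Qed.

Lemma gram_stable k (M : 'M[F]_k) (g : aut V) (s : family_gset k) :
  gram s = M -> gram (act g s) = M.
Proof. by move=> <-; apply: gram_aut. Qed.

Definition gram_gset k (M : 'M[F]_k) : gset (aut V) := sub_gset (@gram_stable k M).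

Definition gram_class k (M : 'M[F]_k) : B := gset_class (sp_gset F) (gram_gset M).

Lemma gram_smooth k (M : 'M[F]_k) : smooth (sp_gset F) (gram_gset M).
Proof. exact/sub_gset_smooth/family_smooth. Qed.

Lemma gram_fin_orbits k (M : 'M[F]_k) : fin_orbits (gram_gset M).
Proof. exact/sub_gset_fin_orbits/family_fin_orbits. Qed.

(** Recombination by an invertible matrix is an equivariant bijection between families. *)
Lemma gram_class_congr k (P M : 'M[F]_k) : P \in unitmx ->
  gram_class (P *m M *m P^T) = gram_class M.
Proof.
move=> Pu; apply/esym/gset_class_iso; first exact: gram_fin_orbits.
have rP (u : gram_gset M) : gram (recombine P (proj1_sig u)) = P *m M *m P^T.
  by rewrite gram_recombine (proj2_sig u).
pose f u : gram_gset (P *m M *m P^T) := exist _ _ (rP u).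
apply: (@gset_isoI _ _ _ f).
- move=> u v /(congr1 (@proj1_sig _ _)) e; apply: sig_val_inj.
  exact: (can_inj (recombineK (mulVmx Pu))) e.
- move=> [s sM]; have gs : gram (recombine (invmx P) s) = M.
    rewrite gram_recombine sM trmx_inv !mulmxA mulVmx // mul1mx -mulmxA.
    by rewrite mulmxV ?unitmx_tr // mulmx1.
  exists (exist _ _ gs : gram_gset M); apply: sig_val_inj.
  exact: (recombineK (mulmxV Pu)).
- move=> g u; apply: sig_val_inj; apply: funext => i.
  exact/esym/aut_lin.
Qed.

(** A pair of families is their concatenation; [A] records the cross pairings, which are invariant
    under the group. *)
Lemma gram_class_mul m n (M : 'M[F]_m) (N : 'M[F]_n) :
  gram_class M * gram_class N = \sum_A gram_class (block_mx M A (- A^T) N).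
Proof.
pose X := prod_gset (gram_gset M) (gram_gset N).
pose f (u : X) : 'M[F]_(m, n) := \matrix_(i, j) sform (proj1_sig u.1 i) (proj1_sig u.2 j).
have fG A g u : f u = A -> f (act g u) = A.
  by move=> <-; apply/matrixP => i j; rewrite !mxE; exact: aut_isometric.
have Xf : fin_orbits X.
  by apply: (fin_orbits_prod (@inf_oligo F)); do ?exact: gram_smooth; exact: gram_fin_orbits.
transitivity (gset_class (sp_gset F) X).
  symmetry; apply: (gset_class_prod (@inf_oligo F)); do ?exact: gram_smooth;
    exact: gram_fin_orbits.
rewrite (gset_class_fibers _ fG Xf); apply: eq_bigr => A _.
apply: gset_class_iso; first exact: sub_gset_fin_orbits.
have hP (u : sub_gset (fG A)) :
    gram (fcat (proj1_sig (proj1_sig u).1) (proj1_sig (proj1_sig u).2)) =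
    block_mx M A (- A^T) N.
  have uA : f (proj1_sig u) = A := proj2_sig u.
  by rewrite gram_fcat (proj2_sig (proj1_sig u).1) (proj2_sig (proj1_sig u).2)
    -(congr1 (fun Z => block_mx M Z (- Z^T) N) uA).
pose h u : gram_gset (block_mx M A (- A^T) N) := exist _ _ (hP u).
apply: (@gset_isoI _ _ _ h).
- move=> [[[s sM] [t tN]] /= stA] [[[s' sM'] [t' tN']] /= stA'].
  move=> /(congr1 (@proj1_sig _ _)) /= e.
  have es : s = s' by apply: funext => i; rewrite -(fcatl s t) e fcatl.
  have et : t = t' by apply: funext => i; rewrite -(fcatr s t) e fcatr.
  apply: sig_val_inj => /=; congr pair; exact: sig_val_inj.
- move=> [s sE].
  have sA i j : sform (s i) (s j) = block_mx M A (- A^T) N i j by rewrite -sE mxE.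
  have s1 : gram (fun i => s (lshift n i)) = M.
    by apply/matrixP => i j; rewrite mxE sA block_mxEul.
  have s2 : gram (fun i => s (rshift m i)) = N.
    by apply/matrixP => i j; rewrite mxE sA block_mxEdr.
  have s3 : f (exist _ _ s1, exist _ _ s2) = A.
    by apply/matrixP => i j; rewrite mxE sA block_mxEur.
  exists (exist (fun u => f u = A) _ s3); apply: sig_val_inj; apply: funext => i /=.
  by case: (split_ordP i) => j ->; rewrite ?fcatl ?fcatr.
- move=> g u; apply: sig_val_inj; apply: funext => i /=.
  by rewrite /fcat; case: fintype.split.
Qed.

Lemma gram_class0 (M : 'M[F]_0) : gram_class M = 1.
Proof.
rewrite -[RHS]/(gset_class (sp_gset F) (unit_gset (aut V))).
apply: gset_class_iso; first exact: gram_fin_orbits.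
apply: (@gset_isoI _ (gram_gset M) (unit_gset (aut V)) (fun _ => tt)) => //.
- by move=> u v _; apply: sig_val_inj; apply: funext => -[].
- have sM : gram (fun _ => 0 : V) = M by apply/matrixP => -[].
  by move=> []; exists (exist (fun s : family_gset 0 => gram s = M) _ sM).
Qed.

(** An embedding of the hyperbolic plane is the same thing as the hyperbolic pair of the images of
    [e] and [f]. *)
Lemma embedding_class10 : embedding_class F 1 0 = gram_class (hyp_mx 1).
Proof.
pose e : std_space F 1 0 := (const_mx 1, 0, 0).
pose f : std_space F 1 0 := (0, const_mx 1, 0).
pose pair (v w : V) := fcat (fun _ : 'I_1 => v) (fun _ : 'I_1 => w).
have pairP v w : gram (pair v w) = hyp_mx 1 <-> sform v w = 1.
  rewrite gram_fcat; split=> [/eq_block_mx [_ /matrixP vw _ _]|vw].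
    by have := vw 0 0; rewrite !mxE eqxx.
  by congr block_mx; apply/matrixP => i j; rewrite !ord1 !mxE ?sform_alt ?vw.
apply: gset_class_iso; first exact: embedding_fin_orbits.
have phiP (phi : embedding_gset (std_space F 1 0) V) :
    gram (pair (val phi e) (val phi f)) = hyp_mx 1.
  have [_ _ phiE] := set_mem (valP phi); apply/pairP; rewrite phiE.
  by rewrite /sform /= /std_form big_ord1 /= !mxE; ring.
pose h phi : gram_gset (hyp_mx 1) := exist _ _ (phiP phi).
have decomp (x : std_space F 1 0) : x = x.1.1 0 0 *: e + x.1.2 0 0 *: f.
  case: x => [[a b] c]; congr (_, _, _); apply/rowP => i; rewrite ?ord1 ?mxE /=.
  - by rewrite mulr1 mulr0 addr0.
  - by rewrite mulr1 mulr0 add0r.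
  - by case: i.
apply: (@gset_isoI _ _ _ h).
- move=> phi psi /(congr1 (@proj1_sig _ _)) /= E.
  have [phiL _ _] := set_mem (valP phi); have [psiL _ _] := set_mem (valP psi).
  apply: val_inj; apply: funext => x.
  have Ee : val phi e = val psi e.
    by have := congr1 (@^~ (lshift 1 0)) E; rewrite /pair /= !fcatl.
  have Ef : val phi f = val psi f.
    by have := congr1 (@^~ (rshift 1 0)) E; rewrite /pair /= !fcatr.
  rewrite (decomp x) -[_ *: f]addr0 !(phiL, psiL) Ee Ef.
  by rewrite (linear_at0 phiL) (linear_at0 psiL).
- move=> [s sM].
  have vw : sform (s (lshift 1 0)) (s (rshift 1 0)) = 1.
    by move/matrixP: sM => /(_ (lshift 1 0) (rshift 1 0)); rewrite mxE block_mxEur mxE eqxx.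
  pose phi (x : std_space F 1 0) : V :=
    x.1.1 0 0 *: s (lshift 1 0) + x.1.2 0 0 *: s (rshift 1 0).
  have phiE : isometric phi.
    move=> x y; rewrite /phi !(linearDl, linearDr) !linearZl_LR !linearZr_LR !sform_alt.
    rewrite (sform_skew (s (rshift 1 0))) vw -[RHS]/(std_form x y).
    by rewrite /std_form big_ord1; ring.
  have phiS : phi \in embeddings (std_space F 1 0) V.
    apply: mem_set; split=> // [a x y|x y xy].
      by rewrite /phi /= !mxE !scalerDl !scalerDr !scalerA addrACA.
    rewrite (decomp x) (decomp y).
    (* Coordinates are recovered from pairings, so preserving the form forces injectivity. *)
    have ex (z : std_space F 1 0) : z.1.1 0 0 = sform (phi z) (phi f).
      by rewrite phiE /sform /= /std_form big_ord1 /= !mxE; ring.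
    have fx (z : std_space F 1 0) : z.1.2 0 0 = - sform (phi z) (phi e).
      by rewrite phiE /sform /= /std_form big_ord1 /= !mxE; ring.
    by rewrite !ex !fx xy.
  exists (SigSub phiS); apply: sig_val_inj; apply: funext => i /=.
  case: (split_ordP i) => j ->; rewrite (ord1 j) /pair ?fcatl ?fcatr /phi /= !mxE;
    by rewrite scale0r scale1r ?addr0 ?add0r.
- move=> g phi; apply: sig_val_inj; apply: funext => i /=.
  by rewrite /pair /fcat; case: fintype.split.
Qed.

(** The nonzero vectors are the embeddings of a line with zero form; the zero vector is a single
    fixed point, of class [1]. *)
Lemma gram_class_point : gram_class (0 : 'M[F]_1) = embedding_class F 0 1 + 1.
Proof.
pose X := gram_gset (0 : 'M[F]_1).
pose f (u : X) : bool := proj1_sig u ord0 == 0.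
have g0 (g : aut V) : val g 0 = 0 by apply/linear_at0/aut_linear.
have fG b g u : f u = b -> f (act g u) = b.
  by move=> <-; rewrite /f -[in LHS](g0 g); apply: (inj_eq (bij_inj (aut_bij g))).
have s0 (v : V) : gram (fun _ : 'I_1 => v) = 0.
  by apply/matrixP => i j; rewrite !mxE sform_alt.
have Xext (u v : X) : proj1_sig u ord0 = proj1_sig v ord0 -> u = v.
  by move=> uv; apply: sig_val_inj; apply: funext => i; rewrite (ord1 i).
have Xf : fin_orbits X by apply: gram_fin_orbits.
rewrite /gram_class (gset_class_fibers _ fG Xf) big_bool /= addrC.
congr (_ + _); apply/esym/gset_class_iso.
- exact: embedding_fin_orbits.
- pose e : std_space F 0 1 := (0, 0, const_mx 1).
  have decomp (x : std_space F 0 1) : x = x.2 0 0 *: e.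
    case: x => [[a b] c]; congr (_, _, _); apply/rowP => i; rewrite ?ord1 ?mxE /=.
    + by case: i.
    + by case: i.
    + by rewrite mulr1.
  have phi0 (phi : embedding_gset (std_space F 0 1) V) :
      f (exist _ _ (s0 (val phi e))) = false.
    have [phiL phiI _] := set_mem (valP phi).
    have p0 : val phi 0 = 0 := linear_at0 phiL.
    apply/eqP; rewrite /= -[in X in _ = X]p0 => /phiI.
    by move=> /(congr1 (fun x : std_space F 0 1 => x.2 0 0)) /eqP; rewrite !mxE oner_eq0.
  pose h phi : sub_gset (fG false) := exist _ _ (phi0 phi).
  apply: (@gset_isoI _ _ _ h).
  + move=> phi psi /(congr1 (fun u => proj1_sig (proj1_sig u) ord0)) /= E.
    have [phiL _ _] := set_mem (valP phi); have [psiL _ _] := set_mem (valP psi).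
    have Ee : val phi e = val psi e := E.
    apply: val_inj; apply: funext => x.
    by rewrite (decomp x) -[_ *: e]addr0 !(phiL, psiL) Ee (linear_at0 phiL) (linear_at0 psiL).
  + move=> [u u0]; pose v := proj1_sig u ord0.
    have v0 : v != 0 by move: u0; rewrite /f => /negbT.
    pose phi (x : std_space F 0 1) : V := x.2 0 0 *: v.
    have phiS : phi \in embeddings (std_space F 0 1) V.
      apply: mem_set; split=> [a x y|x y xy|x y].
      * by rewrite /phi /= !mxE scalerDl scalerA.
      * rewrite (decomp x) (decomp y); congr (_ *: _).
        move/eqP: xy; rewrite -subr_eq0 -scalerBl scaler_eq0 (negbTE v0) orbF subr_eq0.
        by move/eqP.
      * rewrite /phi linearZl_LR linearZr_LR sform_alt -[RHS]/(std_form x y).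
        by rewrite /std_form big_ord0 /= !mulr0.
    exists (SigSub phiS); apply: sig_val_inj; apply: Xext.
    by rewrite /= /phi mxE scale1r.
  + by move=> g phi; apply: sig_val_inj; apply: Xext.
- exact/transitive_fin_orbits/unit_gset_transitive.
- have o0 : f (exist _ _ (s0 0)) = true by apply: eqxx.
  apply: (@gset_isoI _ (unit_gset _) (sub_gset (fG true)) (fun _ => exist _ _ o0)) => //.
  + by move=> [] [].
  + move=> [u u0]; exists tt; apply: sig_val_inj; apply: Xext => /=.
    by apply/esym/eqP.
  + by move=> g x; apply: sig_val_inj; apply: Xext; rewrite /= g0.
Qed.

End GramSets.

(** * Generation of the Burnside ring *)

Lemma mxrank_congr (F : fieldType) k (P M : 'M[F]_k) : P \in unitmx ->
  \rank (P *m M *m P^T) = \rank M.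
Proof.
move=> Pu; rewrite mxrankMfree ?row_free_unit ?unitmx_tr //.
by rewrite eqmxMfull // row_full_unit.
Qed.

(** Eliminates [x = h 0] between the expansions of the two products, with [Q = q ^ k], [n = n1] and
    [y = h 1]; the coefficient left on [y] is [Q ^ 2 * (Q ^ 2 - q * n)], which the counting identity
    turns into [Q ^ 3]. *)
Lemma hyp_elimination (R : comNzRingType) (Q q n x y : R) : q * n + Q = Q * Q ->
  Q * (Q * Q) * y =
  Q * Q * (n * x + (Q * Q - n) * y) - n * (Q * Q * (x + (q - 1) * y)).
Proof.
move=> e; transitivity (Q * Q * (Q * Q - q * n) * y); last by ring.
by rewrite -e; ring.
Qed.

Section Generation.
Variable F : finFieldType.
Local Notation V := (inf_space F).
Local Notation B := (sp_burnside F).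
Local Notation q := #|F|.
(** A subring closed under division by [q] and containing both generators; it is later instantiated
    by the elements whose image in the localization is the value of a polynomial. *)
Variable S : B -> Prop.
Hypothesis S1 : S 1.
Hypothesis SB : forall x y, S x -> S y -> S (x - y).
Hypothesis SM : forall x y, S x -> S y -> S (x * y).
Hypothesis Sq : forall x, S (q%:R * x) -> S x.
Hypothesis Spoint : S (gram_class (0 : 'M[F]_1)).
Hypothesis Shyp : S (gram_class (hyp_mx (1 : F))).

Let S0 : S 0.
Proof. by rewrite -(subrr 1); apply: SB. Qed.

Let SD x y : S x -> S y -> S (x + y).
Proof. by move=> Sx Sy; rewrite -[y]opprK -[- y]add0r; do 2?apply: SB. Qed.

Let Snat n : S n%:R.
Proof. by elim: n => [|n Sn] //; rewrite mulrS; apply: SD. Qed.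

Let Ssum (I : finType) (P : pred I) (x : I -> B) :
  (forall i, P i -> S (x i)) -> S (\sum_(i | P i) x i).
Proof. by move=> Sx; apply: big_ind. Qed.

Let Sqn n x : S ((q ^ n)%:R * x) -> S x.
Proof.
elim: n x => [x|n IH x]; first by rewrite mul1r.
by rewrite expnSr natrM -mulrA => /IH /Sq.
Qed.

Lemma gram_class_clear m n (N : 'M[F]_m) (M : 'M_n) (u : 'M_(m, n)) :
  alternating M -> gram_class (block_mx N (u *m M) (- (u *m M)^T) M) =
  gram_class (block_mx (N - u *m M *m u^T) 0 0 M).
Proof.
move=> /alternating_tr /(congr_clear_right N u) [P Pu <-].
by rewrite gram_class_congr.
Qed.

(** Expand the product of the point class with that of [M]. The [q ^ \rank M] rows [A] in the row
    space of [M] all clear to the same block sum; any other row raises the rank and is covered by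
    the last hypothesis. *)
Lemma mem_singular k (M : 'M[F]_k) : alternating M -> S (gram_class M) ->
  (forall N : 'M_(1 + k), alternating N -> (\rank M < \rank N)%N -> S (gram_class N)) ->
  S (gram_class (block_mx (0 : 'M_1) 0 0 M)).
Proof.
move=> Ma SMk SN; apply: (@Sqn (\rank M)).
pose c (A : 'M[F]_(1, k)) := gram_class (block_mx (0 : 'M_1) A (- A^T) M).
have : S (\sum_A c A) by rewrite -gram_class_mul; apply: SM.
rewrite (bigID (fun A => A <= M)%MS) /=.
rewrite (eq_bigr (fun _ => gram_class (block_mx (0 : 'M_1) 0 0 M))); last first.
  move=> A /submxP [u ->]; rewrite /c gram_class_clear //.
  by rewrite sub0r Ma oppr0.
rewrite sumr_const card_row_space => Sc.
have Sc' : S (\sum_(A | ~~ (A <= M)%MS) c A).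
  apply: Ssum => A AM; apply: SN.
    apply: alternating_block => //; exact: alternating0.
  apply: (@leq_trans (\rank (col_mx A M))).
    rewrite -addsmxE; apply: rank_ltmx.
    by rewrite ltmxE addsmxSr addsmx_sub submx_refl andbT.
  (* [col_mx A M] consists of the last [k] columns of the block matrix, so its rank is a lower
     bound. *)
  rewrite (_ : col_mx A M = block_mx 0 A (- A^T) M *m col_mx 0 1%:M) ?mxrankM_maxl //.
  by rewrite mul_block_col !mulmx0 !mulmx1 !add0r.
by have := SB Sc Sc'; rewrite addrK mulr_natl.
Qed.

(** * Adding a hyperbolic plane to a non-degenerate form *)

Section NonSingular.
Variables (k : nat) (M : 'M[F]_k).
Hypotheses (Ma : alternating M) (Mu : M \in unitmx).

Let h (c : F) := gram_class (block_mx (hyp_mx c) 0 0 M).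
(** The pairing under [M] of the two rows of [u]. *)
Let omega (u : 'M[F]_(1 + 1, k)) : F := (u *m M *m u^T) 0 (rshift 1 0).

(** Rescale the first vector by [c]. *)
Lemma hyp_sum_scale c : c != 0 -> h c = h 1.
Proof.
move=> c0; pose D : 'M[F]_(1 + 1) := block_mx c%:M 0 0 1%:M.
rewrite /h -(@gram_class_congr F _ (block_mx D 0 0 1%:M) (block_mx (hyp_mx 1) 0 0 M)).
  rewrite tr_block_mx !mulmx_block !trmx0 trmx1 !(mul0mx, mulmx0, mul1mx, mulmx1, addr0, add0r).
  congr (gram_class (block_mx _ _ _ _)).
  rewrite /D /hyp_mx tr_block_mx !mulmx_block !trmx0 trmx1 tr_scalar_mx.
  by rewrite !(mul0mx, mulmx0, mul1mx, mulmx1, addr0, add0r) mulNmx mul1mx.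
by rewrite unitmxE det_ublock det1 mulr1 det_ublock det1 mulr1 det_scalar1 unitfE.
Qed.

(** As [M] is invertible, each off-diagonal block is [u *m M] for a unique [u]; clearing it lowers
    the pairing in the plane by [omega u]. *)
Lemma hyp_sum_mul c : gram_class (hyp_mx c) * gram_class M = \sum_u h (c - omega u).
Proof.
rewrite gram_class_mul (reindex (fun u : 'M[F]_(1 + 1, k) => u *m M)) /=; last first.
  by exists (mulmx^~ (invmx M)) => u _; rewrite ?mulmxK ?mulmxKV.
apply: eq_bigr => u _; rewrite gram_class_clear // /h.
have Na : alternating (hyp_mx c - u *m M *m u^T).
  move=> v; rewrite mulmxBr mulmxBl alternating_hyp sub0r.
  by rewrite (alternating_congr u Ma) oppr0.
rewrite (alternating_2 Na) mxE [X in _ + X]mxE.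
suff -> : hyp_mx c 0 (rshift 1 0) = c by [].
have -> : 0 = lshift 1 0 :> 'I_(1 + 1) by apply: val_inj.
by rewrite block_mxEur mxE eqxx.
Qed.

Let n1 := #|[pred u : 'M[F]_(1 + 1, k) | omega u == 1]|.

Lemma card_omega1 : (q * n1 + q ^ k = q ^ k * q ^ k)%N.
Proof.
have e : n1 = #|[pred p : 'rV[F]_k * 'rV_k | (p.1 *m M *m p.2^T == 1)%R]|.
  have ci : injective (fun p : 'rV[F]_k * 'rV[F]_k => col_mx p.1 p.2).
    by move=> [a b] [a' b'] /= /eq_col_mx [-> ->].
  rewrite -(card_imset _ ci); apply: eq_card => u; rewrite inE.
  have oE p : omega (col_mx p.1 p.2) = (p.1 *m M *m p.2^T) 0 0.
    rewrite /omega mul_col_mx tr_col_mx mul_col_row.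
    have -> : 0 = lshift 1 0 :> 'I_(1 + 1) by apply: val_inj.
    by rewrite block_mxEur.
  apply/eqP/imsetP => [u1|[p + ->]]; last by rewrite inE => /eqP E; rewrite oE E mxE.
  exists (usubmx u, dsubmx u); last by rewrite vsubmxK.
  rewrite inE [X in X == _]mx11_scalar -(oE (usubmx u, dsubmx u)) vsubmxK u1.
  exact: eqxx.
by rewrite e; have := card_unit_pairs M; rewrite mxrank_unit // subnn muln1.
Qed.

Lemma sum_omega : \sum_(u : 'M[F]_(1 + 1, k)) h (1 - omega u) =
  n1%:R * h 0 + ((q ^ k * q ^ k)%:R - n1%:R) * h 1.
Proof.
have cT : (#|{: 'M[F]_(1 + 1, k)}| = q ^ k * q ^ k)%N.
  by rewrite card_mx mulnDl mul1n expnD.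
rewrite (bigID (fun u => omega u == 1)) /=; congr (_ + _).
  rewrite (eq_bigr (fun=> h 0)) => [|u /eqP ->]; last by rewrite subrr.
  by rewrite sumr_const mulr_natl.
rewrite (eq_bigr (fun=> h 1)) => [|u u1]; last first.
  by rewrite hyp_sum_scale // subr_eq0 eq_sym.
rewrite sumr_const -[LHS]mulr_natl; congr (_ * _).
rewrite -cT -(cardC [pred u : 'M[F]_(1 + 1, k) | omega u == 1]) natrD addrAC subrr add0r.
by [].
Qed.

Lemma point_mul2 : gram_class (0 : 'M[F]_1) * gram_class (0 : 'M[F]_1) * gram_class M =
  (q ^ k * q ^ k)%:R * (h 0 + (q%:R - 1) * h 1).
Proof.
have -> : gram_class (0 : 'M[F]_1) * gram_class (0 : 'M[F]_1) =
    \sum_(c : F) gram_class (hyp_mx c).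
  rewrite gram_class_mul (reindex (fun c : F => c%:M : 'M_1)) /=; last first.
    by exists (fun A => A 0 0) => [c _|A _]; rewrite -?mx11_scalar // mxE eqxx.
  by apply: eq_bigr => c _; rewrite tr_scalar_mx.
rewrite mulr_suml; under eq_bigr do rewrite hyp_sum_mul.
(* For fixed [u] the shift by [omega u] permutes the field, so the inner sum does not depend on
   [u]. *)
rewrite exchange_big /= (eq_bigr (fun=> h 0 + (q%:R - 1) * h 1)); last first.
  move=> u _; rewrite (reindex (+%R^~ (omega u))) /=; last first.
    by exists (+%R^~ (- omega u)) => c _; rewrite ?addrK ?subrK.
  under eq_bigr do rewrite addrK.
  rewrite (bigD1 0) //= (eq_bigr (fun=> h 1)) => [|c]; last exact: hyp_sum_scale.
  rewrite sumr_const -[_ *+ _ in LHS]mulr_natl; congr (_ + _ * _).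
  by rewrite -(cardC (pred1 (0 : F))) card1 natrD addrAC subrr add0r.
by rewrite sumr_const card_mx mulnDl mul1n expnD mulr_natl.
Qed.

Lemma mem_hyp_sum : S (gram_class M) -> S (h 1).
Proof.
move=> SMk; apply: (@Sqn (k + (k + k))).
have -> : (q ^ (k + (k + k)))%:R * h 1 =
    (q ^ k * q ^ k)%:R * (gram_class (hyp_mx 1) * gram_class M) -
    n1%:R * (gram_class (0 : 'M[F]_1) * gram_class (0 : 'M[F]_1) * gram_class M).
  rewrite hyp_sum_mul sum_omega point_mul2 !expnD !natrM.
  apply: hyp_elimination; rewrite -!natrM -natrD; congr _%:R; exact: card_omega1.
by apply: SB; do ?apply: SM.
Qed.
End NonSingular.

(** Induction on the size, then on the corank. An invertible matrix loses a hyperbolic plane; a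
    singular one loses a zero line, at the cost of matrices of the same size and larger rank. *)
Lemma mem_gram_class k (M : 'M[F]_k) : alternating M -> S (gram_class M).
Proof.
have [n] := ubnP k; elim: n k M => // n IHn [|k] M; first by rewrite gram_class0.
rewrite ltnS => kn; have [r] := ubnP (k.+1 - \rank M).
elim: r M => // r IHr M Mr Ma; have [Mu|Mu] := boolP (M \in unitmx).
  case: k kn M IHr Mr Ma Mu => [|k] kn M IHr Mr Ma Mu.
    by move: Mu; rewrite (alternating_1 Ma) unitmxE det0 unitr0.
  have [P Pu [M' [M'a M'u] PE]] := @alternating_unit F k M Ma Mu.
  rewrite -(gram_class_congr M Pu) PE; apply: mem_hyp_sum => //.
  by apply: IHn => //; apply: leq_trans kn; apply: leqnSn.
have [P Pu [M' M'a PE]] := @alternating_singular F k M Ma Mu.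
rewrite -(gram_class_congr M Pu) PE; apply: mem_singular => //.
  by apply: IHn.
move=> N Na MN; apply: IHr => //.
have rM : \rank M = \rank M'.
  have e := rank_diag_block_mx (0 : 'M[F]_1) M'; rewrite mxrank0 add0n in e.
  by rewrite -(mxrank_congr M Pu) PE.
rewrite ltnS in Mr; apply: leq_trans Mr; rewrite rM; apply: ltn_sub2l => //.
by apply: (leq_trans MN); apply: rank_leq_row.
Qed.

(** * From Gram classes to transitive classes *)

Lemma basis_stabilizer (l : seq V) : exists k (t : 'I_k -> V),
  [/\ independent t, forall i, t i \in l &
   forall g : aut V, (forall x, x \in l -> val g x = x) <->
     stabilizer (t : family_gset F k) g].
Proof.
have [k [t [ti tl lt]]] := exists_basis l; exists k, t; split=> // g; split=> [gl|gt].
  by apply: funext => i; apply: gl.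
by move=> x /tl [c ->]; rewrite aut_lin; congr lin; exact: gt.
Qed.

(** Stabilizers fix a finite list of vectors pointwise, and a basis extracted from the list has the
    same pointwise stabilizer. *)
Lemma transitive_family X : gset_transitive X -> smooth (sp_gset F) X ->
  exists k (t : 'I_k -> V), independent t /\
    gset_iso X (orbit_gset (orbit_of (t : family_gset F k))).
Proof.
move=> [x xT] Xs; have [s xs] := smooth_tuple x Xs.
have [k [t [ti _ tE]]] := basis_stabilizer s; exists k, t; split=> //.
apply: iso_trans (transitive_iso xT) _; apply: orbit_iso; rewrite xs predeqE => g.
split=> [gs|/tE gs]; last exact: map_id_in.
apply/tE => y ys; have /eq_in_map gs' : map (val g) s = map id s by rewrite map_id.
exact: gs'.
Qed.

Lemma independent_reindex k (s : 'I_k -> V) (a : 'I_k -> 'I_k) :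
  bijective a -> independent (s \o a) -> independent s.
Proof.
move=> [b ab ba] si c; rewrite /lin (reindex a) /=; last by exists b => i _.
move=> e; have /si /rowP c0 : lin (s \o a) (\row_i c 0 (a i)) = 0.
  by rewrite -[RHS]e; apply: eq_bigr => i _; rewrite mxE.
by apply/rowP => i; have := c0 (b i); rewrite !mxE ba.
Qed.

(** An independent family picks its vectors at distinct places of [s]; with as many places as [s]
    has, it would be a reindexing of [s], making [s] independent. *)
Lemma dependent_basis_lt k n (s : 'I_k -> V) (t : 'I_n -> V) :
  independent t -> (forall i, t i \in codom s) -> ~ independent s -> (n < k)%N.
Proof.
move=> ti ts si; pose a i := iinv (ts i).
have sa : s \o a = t by apply: funext => i; apply: f_iinv.
have ai : injective a.
  move=> i j ij; have tij : t i = t j by rewrite -sa /= ij.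
  have : delta_mx 0 i = delta_mx 0 j :> 'rV[F]_n.
    by apply: (independent_inj ti); rewrite !lin_delta.
  move=> /rowP /(_ i); rewrite !mxE !eqxx /=.
  by case: eqP => // _ /eqP; rewrite oner_eq0.
have := leq_card a ai; rewrite !card_ord leq_eqVlt => /orP[/eqP nk|//].
case: si; move: t ti ts a sa ai; rewrite nk => t ti ts a sa ai.
by apply: (@independent_reindex _ s a); [apply: injF_bij | rewrite sa].
Qed.

(** Induction on the length: the orbit of [t] is isolated from the class of its Gram matrix by
    removing the other orbits. *)
Lemma mem_orbit_class n (t : 'I_n -> V) : independent t ->
  S (transitive_class (sp_gset F) (orbit_gset (orbit_of (t : family_gset F n)))).
Proof.
have [m] := ubnP n; elim: m n t => // m IH n t nm ti.
have [N [r [rc ri]]] := gram_fin_orbits (gram t).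
pose u0 : gram_gset (gram t) := exist _ t erefl.
have [i0 i0P] := rc u0.
have Sg := mem_gram_class (gram_alternating t).
rewrite /gram_class (gset_class_transversal _ (conj rc ri)) (bigD1 i0) //= in Sg.
have e0 : transitive_class (sp_gset F) (orbit_gset (orbit_of (r i0))) =
    transitive_class (sp_gset F) (orbit_gset (orbit_of (t : family_gset F n))).
  rewrite (_ : orbit_of (r i0) = orbit_of u0).
    by apply/transitive_class_eq/orbit_iso; rewrite sub_gset_stabilizer.
  by apply: val_inj; apply: orbit_eq.
rewrite -e0 -[X in S X](addrK (\sum_(i | i != i0)
  transitive_class (sp_gset F) (orbit_gset (orbit_of (r i))))).
apply: SB => //; apply: Ssum => i ii0.
(* By Witt's theorem an independent family with this Gram matrix lies in the orbit of [t]. *)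
have rdep : ~ independent (proj1_sig (r i)).
  move=> ui; have [g gr] := witt ui ti (proj2_sig (r i)).
  case/eqP: ii0; apply/esym/ri; rewrite (orbit_eq i0P); apply/sub_gset_orbit.
  exists g^-1%g => //; apply: funext => j.
  by rewrite -[RHS](aut_inv_funK g); congr aut_inv_fun; rewrite gr.
have [k [s [si sr sE]]] := basis_stabilizer (codom (proj1_sig (r i))).
rewrite (_ : transitive_class _ _ = transitive_class (sp_gset F)
   (orbit_gset (orbit_of (s : family_gset F k)))).
  apply: IH => //; rewrite ltnS in nm; apply: leq_trans nm.
  exact: dependent_basis_lt si sr rdep.
apply/transitive_class_eq/orbit_iso; rewrite sub_gset_stabilizer predeqE => g.
split=> [gr|/sE gr]; last by apply: funext => j; apply: gr; apply: codom_f.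
apply/sE => _ /codomP [j ->]; exact: (congr1 (@^~ j) gr).
Qed.

Lemma mem_burnside x : S x.
Proof.
apply: burnside_ind x => // k; rewrite -gset_class_rep.
have [kt ks _] := class_repP k.
rewrite (gset_class_transitive _ kt).
have [n [t [ti /transitive_class_eq ->]]] := transitive_family kt ks.
exact: mem_orbit_class.
Qed.

End Generation.

(** * Marks of families *)

Section FamilyMarks.
Variable F : finFieldType.
Local Notation V := (inf_space F).
Local Notation B := (sp_burnside F).
Local Notation q := #|F|.
Variables (K : nat) (t : 'I_K -> V).
Hypothesis ti : independent t.

Definition fixator : set (aut V) := stabilizer (t : family_gset F K).

Lemma fixed_vectorP (x : V) :
  (forall g, fixator g -> val g x = x) <-> exists c, lin t c = x.
Proof.
split=> [xfix|[c <-] g gt]; last by rewrite aut_lin; congr lin.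
have [|c ->] := @fixed_lin F K t x ti; last by exists c.
by move=> g gt; apply: xfix; apply: funext.
Qed.

Lemma fixed_familyP n (s : family_gset F n) :
  fixed_by fixator s <-> forall i, exists c, lin t c = s i.
Proof.
split=> [sfix i|H g gt]; last by apply: funext => i; apply: (fixed_vectorP _).2.
by apply/fixed_vectorP => g /sfix /(congr1 (@^~ i)).
Qed.

(** Fixed points in an orbit of families are families in the span of [t], so their coordinates lie
    in a finite set. *)
Lemma fixator_finite X : gset_transitive X -> smooth (sp_gset F) X ->
  exists n, fix_count fixator X n.
Proof.
move=> Xt Xs; have [n [s [_ Xs']]] := transitive_family Xt Xs.
pose O := orbit_gset (orbit_of (s : family_gset F n)).
suff [m Om] : exists m, fix_count fixator O m.
  by exists m; apply: fix_count_iso Om; apply: iso_sym.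
pose coord (v : V) : 'rV[F]_K := xget 0 [set c | lin t c = v]%classic.
have coordK v : (exists c, lin t c = v) -> lin t (coord v) = v.
  by move=> /(xgetPex 0).
apply: (@fix_count_finite _ _ O {ffun 'I_n -> 'rV[F]_K}
   (fun u => [ffun i => coord ((val u : family_gset F n) i)])).
have Ofix (u : O) : fixed_by fixator u -> fixed_by fixator (val u : family_gset F n).
  by move=> uf g /uf /(congr1 val).
move=> u v /Ofix /fixed_familyP uf /Ofix /fixed_familyP vf /ffunP e.
apply: val_inj; apply: funext => i; rewrite -(coordK _ (uf i)) -(coordK _ (vf i)).
by have := e i; rewrite !ffunE => ->.
Qed.

Definition family_mark (x : B) : int := @mark _ (sp_gset F) fixator x.

Lemma family_mark_zmod : zmod_morphism family_mark.
Proof. exact: mark_zmod_morphism. Qed.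

Lemma family_mark_monoid : monoid_morphism family_mark.
Proof.
split; first exact: (mark1 fixator_finite).
exact: (markM (@inf_oligo F) fixator_finite).
Qed.


Lemma family_mark_gram k (M : 'M[F]_k) n : fix_count fixator (gram_gset M) n ->
  family_mark (gram_class M) = n%:Z.
Proof.
apply: (mark_gset_class fixator_finite); first exact: gram_smooth.
exact: gram_fin_orbits.
Qed.

Lemma fixed_gramP k (M : 'M[F]_k) (u : gram_gset M) :
  fixed_by fixator u <-> forall i, exists c, lin t c = proj1_sig u i.
Proof.
rewrite -fixed_familyP; split=> uf g /uf; first by move=> /(congr1 (@proj1_sig _ _)).
by move=> gu; apply: sig_val_inj.
Qed.

Lemma family_mark_point : family_mark (gram_class (0 : 'M[F]_1)) = (q ^ K)%N%:Z.
Proof.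
apply: family_mark_gram; rewrite -(card_rV F K).
have gP (c : 'rV[F]_K) : gram (fun _ : 'I_1 => lin t c) = 0.
  by apply/matrixP => i j; rewrite !mxE sform_alt.
pose f c : gram_gset (0 : 'M[F]_1) := exist _ _ (gP c).
apply: (@fix_countI _ _ _ _ f).
  by move=> c d /(congr1 (fun u => proj1_sig u ord0)) /= /(independent_inj ti).
move=> u; rewrite fixed_gramP; split=> [/(_ ord0) [c cu]|[c <-] i]; last by exists c.
by exists c; apply: sig_val_inj; apply: funext => i; rewrite (ord1 i).
Qed.

(** The fixed points are the pairs in the span of [t] with pairing one, which [card_unit_pairs]
    counts. *)
Lemma family_mark_hyp : exists2 n : nat, family_mark (gram_class (hyp_mx 1)) = n%:Z &
  (q * n + q ^ K * q ^ (K - \rank (gram t)) = q ^ K * q ^ K)%N.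
Proof.
pose T := {p : 'rV[F]_K * 'rV[F]_K | p.1 *m gram t *m p.2^T == 1}.
exists #|{: T}|; last by rewrite card_sig; exact: card_unit_pairs.
apply: family_mark_gram.
have gP (p : T) : gram (fcat (fun _ : 'I_1 => lin t (val p).1)
    (fun _ : 'I_1 => lin t (val p).2))
   = hyp_mx 1.
  rewrite gram_fcat; congr block_mx; apply/matrixP => i j; rewrite !ord1 !mxE ?sform_alt //;
    by rewrite sform_lin (eqP (valP p)) mxE.
pose f p : gram_gset (hyp_mx (1 : F)) := exist _ _ (gP p).
apply: (@fix_countI _ _ _ _ f).
  move=> [[a b] abP] [[a' b'] abP'] /(congr1 (@proj1_sig _ _)) /= e; apply: val_inj => /=.
  congr pair; apply: (independent_inj ti).
    by have := congr1 (@^~ (lshift 1 0)) e; rewrite /= !fcatl.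
  by have := congr1 (@^~ (rshift 1 0)) e; rewrite /= !fcatr.
move=> u; rewrite fixed_gramP; split=> [uf|[p <-] i]; last first.
  by case: (split_ordP i) => j ->; rewrite /= ?fcatl ?fcatr; eexists.
have [a au] := uf (lshift 1 0); have [b bu] := uf (rshift 1 0).
have abP : (a, b).1 *m gram t *m (a, b).2^T == 1.
  rewrite [X in X == _]mx11_scalar -sform_lin au bu.
  move/matrixP: (proj2_sig u) => /(_ (lshift 1 0) (rshift 1 0)).
  by rewrite mxE block_mxEur => ->; rewrite mxE eqxx.
exists (Sub (a, b) abP); apply: sig_val_inj; apply: funext => i /=.
by case: (split_ordP i) => j ->; rewrite (ord1 j) ?fcatl ?fcatr.
Qed.

End FamilyMarks.

(** The first [a] vectors [inf_e] and the first [b] vectors [inf_f] form [b] hyperbolic pairs and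
    [a - b] vectors in the radical. *)
Lemma standard_family (F : finFieldType) (a b : nat) : (b <= a)%N ->
  exists2 t : 'I_(a + b) -> inf_space F, independent t &
    \rank (gram t) = (b + b)%N.
Proof.
move=> ba; exists (fcat (fun i : 'I_a => inf_e F i) (fun i : 'I_b => inf_f F i)).
  move=> c; rewrite lin_fcat => e; rewrite -[c]hsubmxK -row_mx0; congr row_mx; apply/rowP => i.
    have := congr1 (fun p : {poly F} => p`_i) (congr1 fst e); rewrite coef0.
    move/(etrans (esym (etrans (coefD _ _ _)
      (congr2 +%R (lin_coef1 _ _ _) (lin_coef1 _ _ _))))) => /=.
    rewrite [X in _ + X]big1 ?addr0 => [|j _]; last by rewrite coef0 mulr0.
    rewrite (bigD1 i) //= coefXn eqxx mulr1 big1 ?addr0 => [->|j ji]; first by rewrite mxE.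
    by rewrite coefXn val_eqE eq_sym (negbTE ji) mulr0.
  have := congr1 (fun p : {poly F} => p`_i) (congr1 snd e); rewrite coef0.
    move/(etrans (esym (etrans (coefD _ _ _)
      (congr2 +%R (lin_coef2 _ _ _) (lin_coef2 _ _ _))))) => /=.
  rewrite [X in X + _]big1 ?add0r => [|j _]; last by rewrite coef0 mulr0.
  rewrite (bigD1 i) //= coefXn eqxx mulr1 big1 ?addr0 => [->|j ji]; first by rewrite mxE.
  by rewrite coefXn val_eqE eq_sym (negbTE ji) mulr0.
rewrite gram_fcat; set A := \matrix_(i, j) _.
have -> : A = pid_mx b.
  apply/matrixP => i j; rewrite !mxE sform_ef; congr (_%:R).
  by case: eqP => //= ->; rewrite ltn_ord.
have -> : gram (fun i : 'I_a => inf_e F i) = 0 by apply/matrixP => i j; rewrite !mxE sform_ee.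
have -> : gram (fun i : 'I_b => inf_f F i) = 0 by apply/matrixP => i j; rewrite !mxE sform_ff.
(* Swapping the block columns makes the matrix block diagonal without changing its rank. *)
rewrite -(mxrankMfree (block_mx 0 (pid_mx b : 'M[F]_(a, b)) (- (pid_mx b)^T) 0)
  (_ : row_free (block_mx 0 1%:M 1%:M 0 : 'M[F]_(a + b, b + a)))).
  rewrite mulmx_block !(mul0mx, mulmx0, mulmx1, addr0, add0r) rank_diag_block_mx.
  by rewrite mxrank_opp mxrank_tr rank_pid_mx.
apply/row_freeP; exists (block_mx 0 1%:M 1%:M 0).
by rewrite mulmx_block !(mul0mx, mulmx0, mulmx1, addr0, add0r) -scalar_mx_block.
Qed.

(** * The isomorphism *)

Section Evaluation.
Variable F : finFieldType.
Local Notation B := (sp_burnside F).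
Local Notation Binv := (sp_burnside_inv F).
Local Notation q := #|F|.

Lemma card_field_neq0 : (q%:R : rat) != 0.
Proof.
by rewrite Num.Theory.pnatr_eq0 -lt0n; apply/card_gt0P; exists 0.
Qed.

Lemma family_mark_lift K (t : 'I_K -> inf_space F) : independent t ->
  exists nu : {rmorphism Binv -> rat},
    forall b m, nu (away_frac _ b m) = (family_mark t b)%:~R / q%:R ^+ m.
Proof.
move=> ti.
pose mA := GRing.isZmodMorphism.Build _ _ (family_mark t) (family_mark_zmod t).
pose mM := GRing.isMonoidMorphism.Build _ _ (family_mark t) (family_mark_monoid ti).
pose mark : {rmorphism B -> int} := HB.pack (family_mark t) mA mM.
pose f : {rmorphism B -> rat} := intr \o mark.
have fq : f q%:R * q%:R^-1 = 1 by rewrite rmorph_nat divff // card_field_neq0.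
have [g gE] := away_universal fq; exists g => b m.
by rewrite [LHS]gE exprVn.
Qed.

(** The mark of the empty family is a ring morphism to [rat], where [1] is nonzero. *)
Lemma Binv_oner_neq0 : (1 : Binv) != 0.
Proof.
have [t ti _] := @standard_family F 0 0 isT.
have [nu _] := family_mark_lift ti.
by apply/eqP => /(congr1 nu) /eqP; rewrite rmorph1 rmorph0 oner_eq0.
Qed.

HB.instance Definition _ := GRing.PzSemiRing_isNonZero.Build Binv Binv_oner_neq0.

Lemma Zinv_to (R : comPzRingType) (u : R) : q%:R * u = 1 ->
  exists g : {rmorphism Zinv F -> R}, forall a m, g (away_frac _ a m) = a%:~R * u ^+ m.
Proof.
move=> qu; have fr : (intr : {rmorphism int -> R}) q%:R * u = 1 by rewrite rmorph_nat.
by have [g gE] := away_universal fr; exists g.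
Qed.

Section Map.
Variables (zeta : {rmorphism Zinv F -> Binv}).
Hypothesis zetaE : forall a m,
  zeta (away_frac _ a m) = a%:~R * away_frac (q%:R : B) 1 1 ^+ m.

Definition generator (i : 'I_2) : Binv :=
  to_away _ (if i == ord0 then embedding_class F 1 0 else embedding_class F 0 1).

Lemma evaluation_surj (x : Binv) : exists p : {mpoly (Zinv F)[2]}, mmap zeta generator p = x.
Proof.
pose phi : {rmorphism {mpoly (Zinv F)[2]} -> Binv} := mmap zeta generator.
have phiC c : phi c%:MP = zeta c by apply: mmapC.
have phiX i : phi 'X_i = generator i by rewrite [LHS]mmapX mmap1U.
pose qV m : Zinv F := away_frac (q%:R : int) 1 m.
have phiV m : phi (qV m)%:MP = away_frac _ 1 m.
  rewrite phiC zetaE mul1r; elim: m => [|m IH]; first by rewrite expr0.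
  by rewrite exprSr IH [LHS]away_mulE mulr1 addn1.
elim/away_ind: x => b m.
(* Since [1 / q ^+ m] is the image of a constant polynomial, only numerators matter. *)
suff [p pb] : exists p, phi p = to_away _ b.
  exists (p * (qV m)%:MP).
  by rewrite [LHS](rmorphM phi) pb phiV -away_frac_to_away.
apply: (mem_burnside (S := fun b => exists p, phi p = to_away _ b)).
- by exists 1; rewrite !rmorph1.
- by move=> x y [p px] [r ry]; exists (p - r); rewrite !rmorphB px ry.
- by move=> x y [p px] [r ry]; exists (p * r); rewrite !rmorphM px ry.
- move=> x [p px]; exists (p * (qV 1%N)%:MP).
  by rewrite rmorphM px rmorphM phiV mulrAC to_away_unit mul1r.
- exists ('X_ord_max + 1); rewrite rmorphD rmorph1 phiX gram_class_point.
  by rewrite rmorphD rmorph1.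
- by exists 'X_ord0; rewrite phiX -embedding_class10.
Qed.

Variable rho : {rmorphism Zinv F -> rat}.
Hypothesis rhoE : forall a m, rho (away_frac _ a m) = a%:~R * q%:R^-1 ^+ m.

Lemma rho_inj : injective rho.
Proof.
move=> x y xy; apply/eqP; rewrite -subr_eq0; apply/eqP.
have : rho (x - y) = 0 by rewrite rmorphB xy subrr.
elim/away_ind: (x - y) => a m; rewrite rhoE => /eqP.
rewrite mulf_eq0 expf_eq0 invr_eq0 (negbTE card_field_neq0) andbF orbF intr_eq0.
by move=> /eqP ->; apply: away_frac_eq; rewrite !mul0r.
Qed.

(** The marks of the two generators at a subspace of dimension [K] and rank [b + b]. *)
Definition mark_x (K b : nat) : rat :=
  ((q ^ K * q ^ K)%:R - (q ^ K * q ^ (K - (b + b)))%:R) / q%:R.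
Definition mark_y (K : nat) : rat := (q ^ K)%:R - 1.

(** The mark [nu] composed with the evaluation is again an evaluation, at the marks of the
    generators. *)
Lemma evaluation_marks K b p : (b + b <= K)%N -> mmap zeta generator p = 0 ->
  mmap rho (fun i => if i == ord0 then mark_x K b else mark_y K) p = 0.
Proof.
move=> bK p0; have bKb : (b <= K - b)%N by rewrite leq_subRL // (leq_trans _ bK) // leq_addl.
have [t ti tr] := standard_family F bKb.
have KE : (K - b + b = K)%N by rewrite subnK // (leq_trans _ bK) // leq_addl.
have [nu nuE] := family_mark_lift ti.
have nuz c : nu (zeta c) = rho c.
  elim/away_ind: c => a m; rewrite zetaE rhoE rmorphM rmorph_int rmorphXn.
  by rewrite nuE (family_mark_monoid ti).1 mul1r expr1.
have nug b' : nu (to_away _ b') = (family_mark t b')%:~R by rewrite [LHS]nuE divr1.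
have nuX i : nu (generator i) = if i == ord0 then mark_x K b else mark_y K.
  rewrite /generator nug; case: ifP => _.
    have [n Xn nE] := family_mark_hyp ti; rewrite embedding_class10 Xn.
    rewrite tr KE in nE; rewrite /mark_x -nE natrD addrK natrM mulrC mulKf //.
    exact: card_field_neq0.
  have -> : embedding_class F 0 1 = gram_class (0 : 'M[F]_1) - 1.
    by rewrite gram_class_point addrK.
  rewrite family_mark_zmod (family_mark_monoid ti).1 family_mark_point // KE.
  by rewrite rmorphB.
rewrite -(rmorph0 nu) -p0 /mmap rmorph_sum; apply: eq_bigr => m _.
rewrite rmorphM nuz /mmap1 rmorph_prod; congr (_ * _); apply: eq_bigr => i _.
by rewrite rmorphXn nuX.
Qed.

Lemma evaluation_inj : injective (mmap zeta generator).
Proof.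
move=> p r /eqP; rewrite -subr_eq0 -[_ - _](rmorphB (mmap zeta generator)) => /eqP pr0.
apply/eqP; rewrite -subr_eq0; apply/eqP; apply: (mpoly2_eq0 rho_inj) => n.
have q1 : (1 < q)%N by exact: card_finNzRing_gt1.
(* Starting at [n + n] ensures that every [b < n] gives a possible rank in dimension [K]. *)
exists [seq mark_y K | K <- iota (n + n)%N n]; split.
- rewrite map_inj_uniq ?iota_uniq // => K K' /addIr /eqP.
  by rewrite Num.Theory.eqr_nat eqn_exp2l // => /eqP.
- by rewrite size_map size_iota.
move=> _ /mapP [K + ->]; rewrite mem_iota => /andP[nK _].
exists [seq mark_x K b | b <- iota 0 n].
have bK b : (b < n)%N -> (b + b <= K)%N.
  by move=> bn; apply: leq_trans nK; rewrite leq_add // ltnW.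
split=> [||_ /mapP [b + ->]].
- rewrite map_inj_in_uniq ?iota_uniq // => b b'.
  rewrite !mem_iota => /andP[_ /bK bb] /andP[_ /bK bb'] /(mulIf _) e.
  have /addrI /oppr_inj /eqP := e (invr_neq0 card_field_neq0).
  rewrite Num.Theory.eqr_nat eqn_pmul2l ?expn_gt0 ?(ltnW q1) // eqn_exp2l // => /eqP e'.
  have e2 : (b + b = b' + b')%N by rewrite -(subKn bb) e' subKn.
  by move: e2; rewrite !addnn => /double_inj.
- by rewrite size_map size_iota.
- rewrite mem_iota => /andP[_ /bK bb]; apply: evaluation_marks => //.
Qed.
End Map.
End Evaluation.

Theorem proposition8p4 (F : finFieldType) :
  exists phi : {rmorphism {mpoly (Zinv F)[2]} -> sp_burnside_inv F},
    [/\ bijective phi,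
        phi 'X_ord0 = to_away _ (embedding_class F 1 0)
      & phi 'X_ord_max = to_away _ (embedding_class F 0 1)].
Proof.
have qB : (#|F|%:R : sp_burnside_inv F) * away_frac (#|F|%:R : sp_burnside F) 1 1 = 1.
  by rewrite -(rmorph_nat (@to_away _ (#|F|%:R : sp_burnside F))) to_away_unit.
have [zeta zetaE] := Zinv_to qB.
have [rho rhoE] := Zinv_to (divff (card_field_neq0 F)).
pose phi : {rmorphism {mpoly (Zinv F)[2]} -> sp_burnside_inv F} :=
  mmap zeta (@generator F).
have phiX i : phi 'X_i = generator F i by rewrite [LHS]mmapX mmap1U.
exists phi; split; rewrite ?phiX //.
pose psi x := projT1 (cid (evaluation_surj zetaE x)).
have psiK : cancel psi phi by move=> x; rewrite /psi; case: cid.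
(* Injectivity makes the chosen right inverse [psi] two-sided. *)
by exists psi => // p; apply: (evaluation_inj zetaE rhoE); rewrite [LHS]psiK.
Qed.
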